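(* Let $e\ge 3$, let $y\in[1,e-1]$ be rational and let $z$ be the denominator of $y$. Then $(ez,yz)$-regularisation defines an isomorphism of crystals $\mathcal R_{A^{y+}}\to\mathcal R_{A^{y-}}$, and the inverse isomorphism is given by $(ez,yz)$-restrictisation.
   Context: Nodes $(r,c)\in\mathbb N^2$ of a Young diagram; residue $c-r+e\mathbb Z$; $i$-node = node of residue $i\in\mathbb Z/e\mathbb Z$. Hook at $(r,c)$: length $\lambda_r-c+\lambda'_c-r+1$, arm length $\lambda_r-c$. An arm sequence is an integer sequence $A=(A_1,A_2,\dots)$ with $t-1\le A_t\le(e-1)t$ and $A_{t+u}\in\{A_t+A_u,A_t+A_u+1\}$ for all $t,u\ge1$; for real $y\in[1,e-1]$, $A^{y+}_t=\lfloor yt\rfloor$ and $A^{y-}_t=\lceil yt-1\rceil$ are arm sequences. A partition is $A$-regular if it has no hook of length $et$ and arm length $A_t$ for any $t\ge1$; $\mathcal R_A$ is the set of $A$-regular partitions. Crystal structure on $\mathcal R_A$: for distinct $i$-nodes $(r,c),(s,d)$ write $s-r+c-d=et$ with the nodes swapped if needed so $t\ge0$, and set $(r,c)\prec(s,d)$ if $c-d\le A_t$ ($A_0:=0$), $(r,c)\succ(s,d)$ otherwise; this is a total order on $i$-nodes. For $\lambda\in\mathcal R_A$ list the addable and removable $i$-nodes as $n_1\succ\dots\succ n_m$, form the signature $s_1\cdots s_m$ ($+$ addable, $-$ removable), and reduce it by repeatedly deleting adjacent pairs $+-$. If the reduced word has a $-$, $e_i\lambda$ is $\lambda$ with the node of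 the last $-$ removed, else $e_i\lambda=0$; if it has a $+$, $f_i\lambda$ is $\lambda$ with the node of the first $+$ added, else $f_i\lambda=0$. It is known that $e_i,f_i$ map $\mathcal R_A$ to $\mathcal R_A\cup\{0\}$ and $e_i\lambda=\mu\iff f_i\mu=\lambda$; the crystal $\mathcal R_A$ is the directed graph on $\mathcal R_A$ with arrows $\lambda\xrightarrow{i}f_i\lambda$. An isomorphism of crystals is a bijection $\alpha$ of vertex sets with $\lambda\xrightarrow{i}\mu$ iff $\alpha(\lambda)\xrightarrow{i}\alpha(\mu)$. For integers $1\le y'<e'$: the $(e',y')$-ladders are the sets $\{(r+k(y'-e'),c+ky'):k\in\mathbb Z\}$; partitions are $(e',y')$-equivalent if they have equally many nodes in each ladder; $(e',y')$-regular means no hook of length $e't$ and arm length $y't-1$ ($t\ge1$), $(e',y')$-restricted means no hook of length $e't$ and arm length $y't$. It is known that each equivalence class contains a unique $(e',y')$-regular partition (dominating all others in the class) and a unique $(e',y')$-restricted partition (dominated by all others); these are the $(e',y')$-regularisation and $(e',y')$-restrictisation of each member of the class. *)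

(* Defs.v *)
From mathcomp Require Import all_boot all_order all_algebra.
From Stdlib Require Import ClassicalEpsilon.
Set Implicit Arguments. Unset Strict Implicit. Unset Printing Implicit Defensive.
Import Order.TTheory GRing.Theory Num.Theory.
Local Open Scope ring_scope.

(* Partitions: nonincreasing sequences of positive naturals.
   Rows and columns are 1-indexed; a node is a pair (r, c) of naturals. *)
Definition is_partition (la : seq nat) : bool :=
  sorted geq la && all (fun x => (0 < x)%N) la.

(* lambda_r (1-indexed, 0 beyond the last row) *)
Definition part_row (la : seq nat) (r : nat) : nat := nth 0%N la r.-1.
Definition conj_col (la : seq nat) (c : nat) : nat := count (fun x => (c <= x)%N) la.

Definition nodes (la : seq nat) : seq (nat * nat) :=
  flatten [seq [seq (r, c) | c <- iota 1 (part_row la r)] | r <- iota 1 (size la)].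

Definition hook_length (la : seq nat) (x : nat * nat) : int :=
  (part_row la x.1)%:Z - x.2%:Z + (conj_col la x.2)%:Z - x.1%:Z + 1.
Definition arm_length (la : seq nat) (x : nat * nat) : int :=
  (part_row la x.1)%:Z - x.2%:Z.

(* residue c - r + eZ, represented in {0,..,e-1} *)
Definition residue (e : nat) (x : nat * nat) : int := ((x.2%:Z - x.1%:Z) %% e%:Z)%Z.

(* Arm sequences are functions t |-> A_t (only t >= 1 is used; A_0 := 0). *)
Definition A_plus (y : rat) : nat -> int := fun t => Num.floor (y * t%:R).
Definition A_minus (y : rat) : nat -> int := fun t => Num.ceil (y * t%:R - 1).

Definition A_regular (e : nat) (A : nat -> int) (la : seq nat) : Prop :=
  forall x t, x \in nodes la -> (0 < t)%N ->
    ~ (hook_length la x = (e * t)%:Z /\ arm_length la x = A t).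
Definition in_RA (e : nat) (A : nat -> int) (la : seq nat) : Prop :=
  is_partition la /\ A_regular e A la.

(* A extended by A_0 := 0, evaluated at an integer t >= 0 *)
Definition Aext (A : nat -> int) (t : int) : int :=
  if absz t is n.+1 then A n.+1 else 0.

(* (r,c) < (s,d) in the order on i-nodes *)
Definition precb (e : nat) (A : nat -> int) (x y : nat * nat) : bool :=
  let r := x.1%:Z in let c := x.2%:Z in let s := y.1%:Z in let d := y.2%:Z in
  let t := ((s - r + c - d) %/ e%:Z)%Z in
  if 0 <= t then c - d <= Aext A t else ~~ (d - c <= Aext A (- t)).

Definition addable (la : seq nat) : seq (nat * nat) :=
  [seq (r, (part_row la r).+1) | r <- iota 1 (size la).+1 &
     (r == 1%N) || ((part_row la r).+1 <= part_row la r.-1)%N].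
Definition removable (la : seq nat) : seq (nat * nat) :=
  [seq (r, part_row la r) | r <- iota 1 (size la) &
     (part_row la r.+1 < part_row la r)%N].

(* signature n_1 > ... > n_m; true = '+' (addable), false = '-' (removable) *)
Definition signature (e : nat) (A : nat -> int) (i : 'I_e) (la : seq nat)
  : seq ((nat * nat) * bool) :=
  sort (fun p q => precb e A q.1 p.1)
    ([seq (x, true) | x <- addable la & residue e x == (i : nat)%:Z] ++
     [seq (x, false) | x <- removable la & residue e x == (i : nat)%:Z]).

Arguments signature : clear implicits.

Fixpoint del_pm (w : seq ((nat * nat) * bool)) : seq ((nat * nat) * bool) :=
  match w with
  | a :: ((b :: w') as w1) => if a.2 && ~~ b.2 then w' else a :: del_pm w1
  | _ => w
  end.
(* repeat until no "+-" pair remains (size w steps suffice) *)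
Definition reduce_sig (w : seq ((nat * nat) * bool)) := iter (size w) del_pm w.

(* f_i lambda: None stands for 0 *)
Definition f_op (e : nat) (A : nat -> int) (i : 'I_e) (la : seq nat)
  : option (seq nat) :=
  match [seq p <- reduce_sig (signature e A i la) | p.2] with
  | p :: _ => Some (incr_nth la p.1.1.-1)
  | [::] => None
  end.

Arguments f_op : clear implicits.

Definition in_ladder (e' y' : int) (p q : nat * nat) : Prop :=
  exists k : int, q.1%:Z = p.1%:Z + k * (y' - e') /\ q.2%:Z = p.2%:Z + k * y'.
Definition ladder_count (e' y' : int) (p : nat * nat) (la : seq nat) : nat :=
  count (fun q => if excluded_middle_informative (in_ladder e' y' p q)
                  then true else false) (nodes la).
Definition ey_equivalent (e' y' : int) (la mu : seq nat) : Prop :=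
  forall p, ladder_count e' y' p la = ladder_count e' y' p mu.
Definition ey_regular (e' y' : int) (la : seq nat) : Prop :=
  forall x (t : nat), x \in nodes la -> (0 < t)%N ->
    ~ (hook_length la x = e' * t%:Z /\ arm_length la x = y' * t%:Z - 1).
Definition ey_restricted (e' y' : int) (la : seq nat) : Prop :=
  forall x (t : nat), x \in nodes la -> (0 < t)%N ->
    ~ (hook_length la x = e' * t%:Z /\ arm_length la x = y' * t%:Z).

(* the (unique) regular / restricted partition equivalent to la *)
Definition regularisation (e' y' : int) (la : seq nat) : seq nat :=
  epsilon (inhabits la)
    (fun mu => is_partition mu /\ ey_regular e' y' mu /\ ey_equivalent e' y' la mu).
Definition restrictisation (e' y' : int) (la : seq nat) : seq nat :=
  epsilon (inhabits la)
    (fun mu => is_partition mu /\ ey_restricted e' y' mu /\ ey_equivalent e' y' la mu).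

(* Main.v *)
Require Import Defs.
From mathcomp Require Import all_boot all_order all_algebra.
From mathcomp Require Import zify ring.
From Stdlib Require Import ClassicalEpsilon FunctionalExtensionality.
Import Order.TTheory GRing.Theory Num.Theory.
Local Open Scope ring_scope.
Set Implicit Arguments. Unset Strict Implicit. Unset Printing Implicit Defensive.

(** Write y = a / z and give the node (r, c) the level a r + (ez - a) c.  The
    orders on nodes of equal residue attached to A^{y+} and A^{y-} both refine
    the order by level, and nodes of equal residue and level form a ladder; the
    two orders are opposite inside each ladder.

    In an A-regular partition no addable i-node n satisfies m < n < m + (1, 1)
    for a removable i-node m.  Hence a removable node may be moved from m to
    m + (1, 1) without changing any cancellation in the signature.  After this
    move, the number of + minus the number of - in each ladder depends only on
    the numbers of nodes of the partition in the ladders, so the level of the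
    good node is the same for two equivalent partitions, one regular for
    A^{y+} and the other for A^{y-}; hence e_i and f_i preserve equivalence.
    Since every nonempty A-regular partition has a removable normal node (one
    of maximal level), induction on the size gives the bijection.  The same
    argument for ez and the integer slope a, whose regular partitions are the
    (ez, a)-regular and (ez, a)-restricted ones, shows that an equivalence class
    contains at most one of each. *)

(** * Reduction of signatures *)

Definition sword := seq ((nat * nat) * bool).
Definition npl (w : sword) : nat := count (fun p => p.2) w.
Definition nmi (w : sword) : nat := count (fun p => ~~ p.2) w.

(* A word whose suffixes have at least as many - as + is one in which every +
   is cancelled; [minus_matched 0] dually says that every - is cancelled. *)
Fixpoint plus_matched (w : sword) : bool :=
  if w is a :: w' then (npl w <= nmi w)%N && plus_matched w' else true.
Fixpoint minus_matched (k : nat) (w : sword) : bool :=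
  match w with
  | [::] => true
  | a :: w' => if a.2 then minus_matched k.+1 w'
               else (0 < k)%N && minus_matched k.-1 w'
  end.

Arguments npl : simpl never.
Arguments nmi : simpl never.

Lemma npl_cat u v : npl (u ++ v) = (npl u + npl v)%N.
Proof. exact: count_cat. Qed.
Lemma nmi_cat u v : nmi (u ++ v) = (nmi u + nmi v)%N.
Proof. exact: count_cat. Qed.
Lemma npl_cons a w : npl (a :: w) = (a.2 + npl w)%N.
Proof. by []. Qed.
Lemma nmi_cons a w : nmi (a :: w) = (~~ a.2 + nmi w)%N.
Proof. by []. Qed.
Definition nE := (npl_cat, nmi_cat, npl_cons, nmi_cons).

Lemma plus_matched_cat u v : plus_matched (u ++ v) -> plus_matched v.
Proof. by elim: u => //= a u IH /andP[_ /IH]. Qed.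

Lemma plus_matched_le u : plus_matched u -> (npl u <= nmi u)%N.
Proof. by case: u => //= a u /andP[]. Qed.

(** The parameter counts the + to the left that are still open. After [u] it has become
    [npl u + k - nmi u], and the middle bound makes this truncated subtraction exact. *)
Lemma minus_matched_cat k u v :
  minus_matched k (u ++ v) ->
  [/\ minus_matched k u, (nmi u <= npl u + k)%N &
      minus_matched (npl u + k - nmi u) v].
Proof.
elim: u k => [|[x []] u IH] k /=.
- by rewrite add0n subn0.
- by move/IH => []; rewrite !nE /= => -> h1; rewrite addnS => h2; split => //; lia.
- case/andP=> k0 /IH[-> h1 h2]; rewrite k0 !nE /=; split=> //; first lia.
  by move: h2; congr minus_matched; lia.
Qed.

Lemma minus_matched_le k u : minus_matched k u -> (nmi u <= npl u + k)%N.
Proof. by rewrite -{1}[u]cats0 => /minus_matched_cat[]. Qed.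

Lemma minus_matched_mono k l u :
  (k <= l)%N -> minus_matched k u -> minus_matched l u.
Proof.
elim: u k l => //= [[x []] u IH] k l kl /=; first by apply: IH; lia.
by case/andP=> k0 /(IH _ l.-1) h; rewrite h; lia.
Qed.

Lemma minus_matched_app k u v : minus_matched k u -> (nmi u <= npl u + k)%N ->
  minus_matched (npl u + k - nmi u) v -> minus_matched k (u ++ v).
Proof.
elim: u k => [|[x []] u IH] k /=; rewrite ?nE /=.
- by rewrite add0n subn0.
- move=> h1 h2 h3; apply: IH => //; first lia.
  by move: h3; congr minus_matched; lia.
- case/andP=> k0 h1 h2 h3; rewrite k0; apply: IH => //; first lia.
  by move: h3; congr minus_matched; lia.
Qed.

(** Every suffix has a nonnegative surplus of - and the whole word a surplus of at most [k], so
    every prefix has a surplus of at most [k]. *)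
Lemma plus_matched_balanced u k :
  plus_matched u -> (nmi u <= npl u + k)%N -> minus_matched k u.
Proof.
elim: u k => //= [[x []] u IH] k; rewrite !nE /= => /andP[h1 h2] h3.
  by apply: IH => //; lia.
have := plus_matched_le h2 => h4.
by rewrite IH //; lia.
Qed.

Lemma minus_matched_balanced u k :
  minus_matched k u -> (npl u + k <= nmi u)%N -> plus_matched u.
Proof.
elim: u k => //= [[x []] u IH] k; rewrite !nE /=.
  by move=> h1 h2; rewrite (IH k.+1) ?andbT //; lia.
by case/andP=> k0 h1 h2; rewrite (IH k.-1) ?andbT //; lia.
Qed.

(** A fully reduced word is a block of - followed by a block of +. With every + of [u] and every -
    of [v] cancelled, [p] is the first surviving + if [b] holds and the last surviving -
    otherwise. *)
Definition good (b : bool) (w u : sword) p v : Prop :=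
  [/\ w = u ++ p :: v, p.2 = b, plus_matched u & minus_matched 0 v].

(** Induction by prepending a letter: the good letter changes only when the new letter is a + for
    which no - is left, and then the new letter becomes good. *)
Lemma plus_matched_or_good w : plus_matched w \/ exists u p v, good true w u p v.
Proof.
elim: w => [|a w [IH|[u [p [v [-> hp hu hv]]]]]]; first by left.
  case h : (npl (a :: w) <= nmi (a :: w))%N; first by left; rewrite /= h.
  right; exists [::], a, w; move: h; rewrite !nE; have := plus_matched_le IH.
  case: a => x [] /= h1 h2; last lia.
  by split=> //; apply: plus_matched_balanced => //; lia.
right; have hu' := plus_matched_le hu.
case h : (npl (a :: u) <= nmi (a :: u))%N.
  by exists (a :: u), p, v; split => //=; rewrite h.
exists [::], a, (u ++ p :: v); move: h; rewrite !nE.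
case: a => x [] /= h; last lia.
split=> //; apply: minus_matched_app; try lia.
  by apply: plus_matched_balanced => //; lia.
by rewrite /= hp; apply: minus_matched_mono hv.
Qed.

Lemma minus_matched_or_good w :
  minus_matched 0 w \/ exists u p v, good false w u p v.
Proof.
elim/last_ind: w => [|w a [IH|[u [p [v [-> hp hu hv]]]]]]; first by left.
  case h : (minus_matched 0 (rcons w a)); first by left.
  right; exists w, a, [::]; rewrite /good cats1.
  have h0 := minus_matched_le IH.
  have h1 : ~~ minus_matched 0 (w ++ [:: a]) by rewrite cats1 h.
  have [h2 h3] : ~~ a.2 /\ (npl w <= nmi w)%N.
    case: a h h1 => x [] h /=; first by rewrite minus_matched_app.
    split=> //; rewrite leqNgt; apply: contraNN h1 => h1.
    by apply: minus_matched_app => //=; lia.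
  split=> //; first exact/negbTE.
  by apply: minus_matched_balanced IH _; lia.
right; rewrite rcons_cat rcons_cons.
case h : (minus_matched 0 (rcons v a)); first by exists u, p, (rcons v a).
have h0 := minus_matched_le hv.
have h1 : ~~ minus_matched 0 (v ++ [:: a]) by rewrite cats1 h.
have [h2 h3] : ~~ a.2 /\ (npl v <= nmi v)%N.
  case: a h h1 => x [] h /=; first by rewrite minus_matched_app.
  split=> //; rewrite leqNgt; apply: contraNN h1 => h1.
  by apply: minus_matched_app => //=; lia.
exists (u ++ p :: v), a, [::]; split=> //.
- by rewrite cats1 rcons_cat.
- exact/negbTE.
have hv' : plus_matched v by apply: minus_matched_balanced hv _; lia.
have hpv : plus_matched (p :: v) by rewrite /= hv' !nE hp; lia.
elim: u hu => //= b u IH /andP[h4 h5]; rewrite IH // andbT.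
by move: h4 (plus_matched_le hpv); rewrite !nE; lia.
Qed.

(** * Deletion of one pair, and the reduced word *)

Lemma del_pm2 a b w :
  del_pm (a :: b :: w) = if a.2 && ~~ b.2 then w else a :: del_pm (b :: w).
Proof. by []. Qed.
Arguments del_pm : simpl never.

Lemma del_pm_count w : (npl (del_pm w) + nmi w = nmi (del_pm w) + npl w)%N.
Proof.
elim: w => // a [|b w] IH; first by rewrite addnC.
rewrite del_pm2; case: ifP => [|_].
  by case/andP; rewrite !nE; case: a.2; case: b.2 => //=; lia.
by rewrite !(nE, npl_cons a, nmi_cons a) in IH *; lia.
Qed.

Lemma plus_matched_del w : plus_matched w -> plus_matched (del_pm w).
Proof.
elim: w => // a [|b w] // IH /andP[h1 h2]; rewrite del_pm2.
case: ifP => _; first by case/andP: h2.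
have h3 := del_pm_count (b :: w).
by rewrite /= IH // andbT; move: h1 h3; rewrite !nE; lia.
Qed.

Lemma minus_matched_del k w : minus_matched k w -> minus_matched k (del_pm w).
Proof.
elim: w k => // a [|b w] // IH k; rewrite del_pm2.
case: ifP => [/andP[/= -> /negbTE->] //|_].
move=> h; change (minus_matched k (a :: del_pm (b :: w))).
move: h; rewrite [minus_matched k (a :: b :: w)]/=.
rewrite -/(minus_matched _ (b :: w)) [minus_matched k (a :: _)]/=.
case: a.2 => h; first exact: (IH k.+1 h).
by case/andP: h => -> h; apply: IH k.-1 h.
Qed.

(** A deleted pair never involves [p]: it is a +, and the letter after it is a + because [v] cannot
    begin with an unmatched -. The balance of [u] is recorded to carry the induction. *)
Lemma good_del w u p v : good true w u p v ->
  exists u' v', good true (del_pm w) u' p v' /\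
    (npl u' + nmi u = nmi u' + npl u)%N.
Proof.
case=> -> {w} hp; elim: u => [|a u IH] hu hv.
  case: v hv => [|b v] hv; first by exists [::], [::].
  have hb : b.2 by move: hv => /=; case: ifP.
  exists [::], (del_pm (b :: v)); split=> //; split=> //.
    by rewrite /= del_pm2 hb andbF.
  exact: minus_matched_del.
have [h1 h2] := andP hu.
have [u' [v' [[e1 _ hu' hv'] e2]]] := IH h2 hv.
(* For empty [u] the default [p] of [head] is the actual next letter, a +, so no pair is deleted
   there. *)
have -> : del_pm ((a :: u) ++ p :: v) =
    if a.2 && ~~ (head p u).2 then behead u ++ p :: v
    else a :: del_pm (u ++ p :: v).
  by case: u {IH h1 h2 hu e1 e2} => [|b u] //=; rewrite del_pm2 // hp andbF.
case: ifP => [|_].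
  case: u {IH e1 e2} hu h1 h2 => [|b u] hu h1 h2; first by rewrite /= hp andbF.
  case/andP=> /= ha hb; exists u, v; split; last by rewrite !nE; lia.
  by split=> //; case/andP: h2.
exists (a :: u'), v'; rewrite e1; split; last by rewrite !nE; lia.
split=> //=; rewrite hu' andbT; move: h1; rewrite !nE; lia.
Qed.

Lemma size_del_pm w : size (del_pm w) = size w \/ (size (del_pm w) < size w)%N.
Proof.
elim: w => [|a [|b w] IH]; try by left.
rewrite del_pm2; case: ifP => _; first by right => /=; lia.
by case: IH => /= IH; [left|right]; lia.
Qed.

Lemma del_pm_fix w : size (del_pm w) = size w -> del_pm w = w.
Proof.
elim: w => [|a [|b w] IH] //; rewrite del_pm2 /=; case: ifP => _; first by lia.
by case=> /= h; rewrite -[X in _ = a :: X]IH.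
Qed.

(** A step that does not shorten the word fixes it, so [size w] steps always end at a fixed
    point. *)
Lemma reduce_fix w : del_pm (reduce_sig w) = reduce_sig w.
Proof.
rewrite /reduce_sig; move: (leqnn (size w)); move: {-1}(size w) => n.
elim: n w => [|n IH] w; first by case: w.
rewrite iterSr => h; case: (size_del_pm w) => h1.
  rewrite (del_pm_fix h1); have : iter n del_pm w = w.
    by elim: n {IH h} => //= n ->; exact: del_pm_fix.
  by move=> ->; exact: del_pm_fix.
by apply: IH; lia.
Qed.

(** In a reduced word only + can follow a +, so a suffix beginning with + would have more + than
    -. *)
Lemma reduced_no_plus w : del_pm w = w -> plus_matched w -> npl w = 0%N.
Proof.
elim: w => // a [|b w] IH.
  by move=> _ /=; rewrite !nE; case: a.2.
rewrite del_pm2; case: ifP => [_ h|h1 [h2]].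
  by have := congr1 size h; rewrite /=; lia.
case/andP=> h3 /(IH h2) h4; move: h3 h4 h1; rewrite !nE.
by case: a.2; case: b.2 => //=; lia.
Qed.

Lemma del_pm_fix_cat u v : del_pm (u ++ v) = u ++ v -> del_pm u = u.
Proof.
elim: u => // a [|b u] IH //; rewrite !cat_cons !del_pm2; case: ifP => [_ h|_ [h]].
  by have := congr1 size h; rewrite /= size_cat; lia.
by rewrite IH.
Qed.

Lemma first_plus_good w u p v : good true w u p v ->
  exists s, [seq q <- reduce_sig w | q.2] = p :: s.
Proof.
move=> h; have := reduce_fix w.
have [u' [v' [-> hp hu _]]] : exists u' v', good true (reduce_sig w) u' p v'.
  rewrite /reduce_sig; elim: (size w) => [|n [u' [v' IH]]]; first by exists u, v.
  by have [x [y [IH' _]]] := good_del IH; exists x, y.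
move=> hfix; suff e : [seq q <- u' | q.2] = [::].
  by exists [seq q <- v' | q.2]; rewrite filter_cat e /= hp.
have := reduced_no_plus (del_pm_fix_cat hfix) hu.
by rewrite /npl -size_filter => /size0nil.
Qed.

Lemma no_plus_reduce w : plus_matched w -> [seq q <- reduce_sig w | q.2] = [::].
Proof.
move=> h; have h1 : plus_matched (reduce_sig w).
  by rewrite /reduce_sig; elim: (size w) => //= n; exact: plus_matched_del.
have := reduced_no_plus (reduce_fix w) h1.
by rewrite /npl -size_filter => /size0nil.
Qed.

(** * Partitions as weakly decreasing functions *)

(** Rows count from 0 here while nodes keep 1-indexed coordinates: row [r] ends at the node
    [(r.+1, rw la r)]. *)
Notation rw la r := (nth 0%N la r).

Lemma partition_anti la r s : is_partition la -> (r <= s)%N -> (rw la s <= rw la r)%N.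
Proof.
move=> /andP[h _] rs; have [hs|hs] := ltnP s (size la); last by rewrite nth_default.
have gtr : transitive geq by move=> x y t /= h1 h2; exact: leq_trans h2 h1.
move: h; rewrite sorted_pairwise // => /(pairwiseP 0%N) h.
move: rs; rewrite leq_eqVlt => /orP[/eqP-> //|rs].
by apply: h => //; rewrite inE //; apply: ltn_trans hs.
Qed.

Lemma partition_size la r : is_partition la -> (r < size la)%N = (0 < rw la r)%N.
Proof.
move=> /andP[_ /all_nthP h]; have [hr|hr] := ltnP r (size la); first by rewrite h.
by rewrite nth_default.
Qed.

Lemma is_partitionP la :
  (forall r, (r < size la)%N -> (0 < rw la r)%N) ->
  (forall r, (rw la r.+1 <= rw la r)%N) -> is_partition la.
Proof.
move=> h1 h2; apply/andP; split; last exact/(all_nthP 0%N).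
by apply/(sortedP 0%N) => i _; apply: h2.
Qed.

Lemma partition_ext la mu : is_partition la -> is_partition mu ->
  (forall r, rw la r = rw mu r) -> la = mu.
Proof.
move=> pl pm h; have hs : size la = size mu.
  suff hlt la1 mu1 : is_partition la1 -> is_partition mu1 ->
      (forall r, rw la1 r = rw mu1 r) -> (size la1 <= size mu1)%N.
    by apply/eqP; rewrite eqn_leq !hlt.
  move=> pl1 pm1 h1; rewrite leqNgt; apply/negP.
  by rewrite partition_size // h1 -partition_size // ltnn.
by apply: (eq_from_nth (x0 := 0%N)).
Qed.

Definition addr la r : bool := (r == 0%N) || (rw la r < rw la r.-1)%N.
Definition remr la r : bool := (rw la r.+1 < rw la r)%N.

Lemma addableP la x : is_partition la ->
  reflect (exists2 r, addr la r & x = (r.+1, (rw la r).+1)) (x \in addable la).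
Proof.
move=> pl; apply: (iffP mapP) => -[r].
  rewrite mem_filter mem_iota; case: r => [|r] /andP[h1 h2] -> //.
  by exists r.
move=> h ->; exists r.+1 => //; rewrite mem_filter mem_iota /=.
case: r h => [|r] //; rewrite /addr /part_row /= => h.
by have := partition_size r pl; lia.
Qed.

Lemma removableP la x : is_partition la ->
  reflect (exists2 r, remr la r & x = (r.+1, rw la r)) (x \in removable la).
Proof.
move=> pl; apply: (iffP mapP) => -[r].
  rewrite mem_filter mem_iota; case: r => [|r] /andP[h1 h2] -> //.
  by exists r.
move=> h ->; exists r.+1 => //; rewrite mem_filter mem_iota /part_row /=.
by have := partition_size r pl; rewrite /remr in h; lia.
Qed.

Lemma partition_incr la r : is_partition la -> addr la r -> is_partition (incr_nth la r).
Proof.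
move=> pl h; have hr : (r <= size la)%N.
  case: r h => // r; rewrite /addr /= => h; rewrite partition_size //; lia.
apply: is_partitionP => s; rewrite ?size_incr_nth !nth_incr_nth.
  have := partition_size s pl; case: ifP => h1; first lia.
  by case: eqP => //; lia.
have h0 := partition_anti pl (leqnSn s).
case: eqP h => [->|_ _]; last by lia.
by rewrite /addr /=; case: eqP => //; lia.
Qed.

Lemma partition_decr la r : is_partition la -> remr la r ->
  exists nu, [/\ is_partition nu, la = incr_nth nu r & addr nu r].
Proof.
move=> pl h.
(* Removing the only node of a row, necessarily the last row, must shorten the list, since entries
   of a partition are positive. *)
pose nu := mkseq (fun j => rw la j - (j == r))%N
   (if rw la r == 1%N then (size la).-1 else size la).
have hr : (r < size la)%N by rewrite partition_size //; rewrite /remr in h; lia.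
have hnu j : rw nu j = (rw la j - (j == r))%N.
  rewrite /nu; set n := (if _ then _ else _); have [hj|hj] := ltnP j n.
    by rewrite nth_mkseq.
  rewrite nth_default ?size_mkseq //; move: hj; rewrite /n.
  case: eqP => h1 hj; last by rewrite nth_default //; lia.
  have h2 : r = (size la).-1.
    apply/eqP; rewrite eqn_leq; apply/andP; split; first by lia.
    by have := partition_size r.+1 pl; rewrite /remr in h; lia.
  have [h3|h3] := eqVneq j r; first by rewrite h3 h1.
  by rewrite nth_default //; lia.
have pn : is_partition nu.
  apply: is_partitionP => s; last first.
    have h0 := partition_anti pl (leqnSn s).
    rewrite !hnu; move: h; rewrite /remr; case: (s =P r) => [->|]; lia.
  rewrite hnu size_mkseq; case: eqP => h1 h2; have := partition_size s pl.
    have h3 : r = (size la).-1.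
      apply/eqP; rewrite eqn_leq; apply/andP; split; first by lia.
      by have := partition_size r.+1 pl; rewrite /remr in h; lia.
    by lia.
  by case: eqP => [->|]; lia.
have an : addr nu r.
  rewrite /addr !hnu; case: r h {hr nu hnu pn} => // r h /=.
  by have := partition_anti pl (leqnSn r); rewrite /remr in h; lia.
exists nu; split=> //.
apply: partition_ext => //; first exact: partition_incr.
by move=> s; rewrite nth_incr_nth hnu; move: h; rewrite /remr; case: eqP => [->|]; lia.
Qed.

(** * The order on nodes *)

Definition cont (x : nat * nat) : int := x.2%:Z - x.1%:Z.

Section Residues.
Variable e : nat.
Implicit Types x y w : nat * nat.

Definition same x y : bool := residue e x == residue e y.

Lemma sameE x y : same x y = (e%:Z %| cont x - cont y)%Z.
Proof. by rewrite /same /residue eqz_mod_dvd. Qed.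
Lemma same_row r c r' c' : same (r.+1, c) (r'.+1, c') = same (r, c) (r', c').
Proof. by rewrite !sameE /cont /=; congr (_ %| _)%Z; lia. Qed.
Lemma same_col r c r' c' : same (r, c.+1) (r', c'.+1) = same (r, c) (r', c').
Proof. by rewrite !sameE /cont /=; congr (_ %| _)%Z; lia. Qed.
Lemma same_eq x y x1 y1 :
  same x y -> cont x - cont y = cont x1 - cont y1 -> same x1 y1.
Proof. by rewrite !sameE => h <-. Qed.
Lemma same_sym x y : same x y = same y x.
Proof. exact: eq_sym. Qed.
Lemma same_trans : transitive same.
Proof. by move=> x y w /eqP h1 /eqP h2; apply/eqP; rewrite h1. Qed.
Lemma same_next_col r c : (2 <= e)%N -> same (r, c.+1) (r, c) = false.
Proof.
move=> e2; rewrite sameE /cont /= (_ : _ - _ = 1); last by lia.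
by rewrite dvdzE /= dvdn1; lia.
Qed.
Lemma same_next_row r c : (2 <= e)%N -> same (r.+1, c) (r, c) = false.
Proof.
move=> e2; rewrite sameE /cont /= (_ : _ - _ = -1); last by lia.
by rewrite dvdzE /= dvdn1; lia.
Qed.

End Residues.

Section NodeOrder.
Variables (e z : nat) (a : int).
Implicit Types (s t : bool) (x y w : nat * nat).
Local Notation same := (same e).

Definition lev x : int := a * x.1%:Z + ((e * z)%:Z - a) * x.2%:Z.
(* [s = true] and [s = false] give the orders attached to A^{y+} and A^{y-}
   with y = a / z: they differ only inside a ladder. *)
Definition nle s x y : bool :=
  (lev x < lev y) ||
  (lev x == lev y) && (if s then cont y <= cont x else cont x <= cont y).

Lemma levE x : lev x = a * x.1%:Z + ((e * z)%:Z - a) * x.2%:Z.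
Proof. by []. Qed.
Lemma lev_row r c : lev (r.+1, c) = lev (r, c) + a.
Proof. rewrite /lev /=; lia. Qed.
Lemma lev_col r c : lev (r, c.+1) = lev (r, c) + ((e * z)%:Z - a).
Proof. rewrite /lev /=; lia. Qed.

Lemma nle_row s r c r' c' : nle s (r.+1, c) (r'.+1, c') = nle s (r, c) (r', c').
Proof. rewrite /nle !lev_row /cont /=; case: s; lia. Qed.
Lemma nle_col s r c r' c' : nle s (r, c.+1) (r', c'.+1) = nle s (r, c) (r', c').
Proof. rewrite /nle !lev_col /cont /=; case: s; lia. Qed.

Lemma nle_lev s x y : nle s x y -> lev x <= lev y.
Proof. rewrite /nle; lia. Qed.

Lemma nle_trans s : transitive (nle s).
Proof. by move=> x y w; rewrite /nle; case: s; lia. Qed.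
Lemma nle_total s : total (nle s).
Proof. by move=> x y; rewrite /nle; case: s; lia. Qed.

Definition shiftE := (nle_row, nle_col, same_row, same_col).

Definition shift11 x : nat * nat := (x.1.+1, x.2.+1).

Lemma nle_shift11 s x y : nle s (shift11 x) (shift11 y) = nle s x y.
Proof. by case: x y => [r c] [r' c']; rewrite /shift11 !shiftE. Qed.

Lemma lev_shift11 x : lev (shift11 x) = lev x + (e * z)%:Z.
Proof. by case: x => r c; rewrite /shift11 /= lev_row lev_col; lia. Qed.

Hypothesis ez0 : (0 < e * z)%N.

(** Level plus [a] times content is [e * z] times the column, so level and content determine the
    node. *)
Lemma nle_anti s : antisymmetric (nle s).
Proof.
move=> [r c] [r' c']; rewrite /nle => h.
have [h1 h2] : lev (r, c) = lev (r', c') /\ cont (r, c) = cont (r', c').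
  by split; move: h; case: s; lia.
move: h1 h2; rewrite /lev /cont /= => h1 h2.
have : (e * z)%:Z * (c'%:Z - c%:Z) = 0 by nia.
move=> h3; have h4 : c = c' :> nat by nia.
by congr pair; lia.
Qed.

Hypothesis e2 : (2 <= e)%N.

(* The hook is at [(r.+1, c.+1)]: the first node compared is just right of the
   end of its row and the second is the foot of its column.  The hook has length
   [e t] and arm length [A_t] exactly when the excluded configuration occurs. *)
Definition regular s la : Prop := forall r c k,
  (c < rw la r)%N -> (c < rw la k)%N -> (rw la k.+1 <= c)%N ->
  same (r.+1, (rw la r).+1) (k.+1, c.+1) ->
  nle s (k.+1, c.+1) (r.+1, (rw la r).+1) ->
  nle s (r.+1, (rw la r).+1) (k.+2, c.+2) -> False.

Lemma regular_window s la n m : is_partition la -> regular s la ->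
  n \in addable la -> m \in removable la -> same n m ->
  nle s m n -> nle s n (shift11 m) = false.
Proof.
move=> pl reg /(addableP _ pl)[r hr ->] /(removableP _ pl)[t ht ->].
rewrite /shift11 /=; move=> h1 h2; apply/negP => h3.
have [rt|tr] := leqP r t.
  have := partition_anti pl rt; move: ht; rewrite /remr.
  case E : (rw la t) h1 h2 h3 => [|c] // h1 h2 h3 ht hr'.
  by apply: (reg r c t); rewrite ?E.
case: r hr h1 h2 h3 tr => // r; rewrite /addr /= => hr h1 h2 h3 tr.
have := partition_anti pl (tr : (t <= r)%N) => htr.
have htr' : (rw la r.+1 < rw la t)%N by apply: leq_trans hr htr.
apply: (reg t (rw la r.+1) r) => //.
- by rewrite same_sym; apply: same_eq h1 _; rewrite /cont /=; lia.
- by move: h3; rewrite !shiftE.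
- by move: h2; rewrite !shiftE.
Qed.

(* A hook becoming tight after adding [n] produces an addable [p] with
   [n <= p <= n + (1, 1)]; the hypothesis says that such a [p] is cancelled
   against a removable node between [n] and [p]. *)
Lemma regular_incr s la r : is_partition la -> regular s la -> addr la r ->
  (forall p, p \in addable la -> same p (r.+1, (rw la r).+1) ->
     p <> (r.+1, (rw la r).+1) -> nle s (r.+1, (rw la r).+1) p ->
     exists q, [/\ q \in removable la, same q (r.+1, (rw la r).+1),
                   nle s (r.+1, (rw la r).+1) q & nle s q p]) ->
  regular s (incr_nth la r).
Proof.
move=> pl reg hr hyp.
have tight p : p \in addable la -> same p (r.+1, (rw la r).+1) -> p <> (r.+1, (rw la r).+1) ->
    nle s (r.+1, (rw la r).+1) p -> nle s p (shift11 (r.+1, (rw la r).+1)) -> False.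
  move=> h1 h2 h3 h4 h5; have [q [q1 q2 q3 q4]] := hyp p h1 h2 h3 h4.
  have pq : same p q by rewrite (same_trans h2) // same_sym.
  have := regular_window pl reg h1 q1 pq q4.
  by rewrite (nle_trans h5) // nle_shift11.
have pi := partition_incr pl hr.
move=> r1 c1 s1; have := partition_anti pl (leqnSn s1).
rewrite !nth_incr_nth.
have [h|h] := eqVneq r r1; last first.
  rewrite add0n => _ h1; have [h2|h2] := eqVneq r s1.
    rewrite -h2 => h3 h4 h5 h6 h7.
    have h8 : rw la r.+1 = rw la r.+1 by [].
    have [h9|h9] := ltnP c1 (rw la r).
      by apply: (reg r1 c1 r) => //; lia.
    have h10 : c1 = rw la r by lia.
    have lr : (r1 < r)%N.
      rewrite ltnNge; apply/negP => hh; have := partition_anti pl hh; lia.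
    case: r hr hyp tight pi h h2 h3 h4 h5 h6 h7 h8 h9 h10 lr => // r hr hyp tight pi.
    move=> h h2 h3 h4 h5 h6 h7 h8 h9 h10 lr.
    (* The foot is the added node. If row [r1] is addable, [tight] applies; otherwise the row above
       has the same length, and raising arm and foot by one row gives a forbidden hook of [la]. *)
    have [h11|h11] := boolP (addr la r1).
      apply: (tight (r1.+1, (rw la r1).+1)); rewrite -?h10 //.
      + by apply/addableP => //; exists r1.
      + by case; lia.
    case: r1 h h1 h5 h6 h7 h11 lr => // r1 h h1 h5 h6 h7; rewrite /addr /= => h11 lr.
    have h12 : rw la r1 = rw la r1.+1.
      by have := partition_anti pl (leqnSn r1); lia.
    apply: (reg r1 c1 r); rewrite ?h12 //; try lia.
    + by move: hr; rewrite /addr /= h10.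
    + by move: h5; rewrite !shiftE.
    + by move: h6; rewrite !shiftE.
    + by move: h7; rewrite !shiftE.
  by rewrite add0n => h3 h4 h5 h6 h7; apply: (reg r1 c1 s1) => //; lia.
rewrite -h add1n => h0 h1 h2 h3 h4 h5 h6.
(* The added node ends the arm. A hook consisting of that node alone has length 1, not divisible by
   [e]. Otherwise the node below the foot is addable and [tight] applies, or the hook one column to
   the left is forbidden in [la]. *)
have [h7|h7] := eqVneq c1 (rw la r).
  have h8 : s1 = r.
    apply/eqP; rewrite eqn_leq; apply/andP; split; rewrite leqNgt; apply/negP => hh.
      by have := partition_anti pl (ltnW hh); lia.
    by have := partition_anti pi (hh : (s1.+1 <= r)%N); rewrite !nth_incr_nth eqxx; lia.
  by move: h4; rewrite h8 h7 same_next_col //.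
have h8 : (c1 < rw la s1)%N by move: h2; case: (eqVneq r s1) => [<-|_]; lia.
have h9 : (rw la s1.+1 <= c1)%N by lia.
have [h10|h10] := eqVneq (rw la s1.+1) c1.
  apply: (tight (s1.+2, (rw la s1.+1).+1)); rewrite /shift11 /=.
  - by apply/addableP => //; exists s1.+1 => //; rewrite /addr /= h10.
  - by rewrite h10 same_sym; apply: same_eq h4 _; rewrite /cont /=; lia.
  - by case; lia.
  - by rewrite h10; move: h6; rewrite !shiftE.
  - by rewrite h10; move: h5; rewrite !shiftE.
case: c1 h1 h2 h3 h4 h5 h6 h7 h8 h9 h10 => [|c1]; first by lia.
move=> h1 h2 h3 h4 h5 h6 h7 h8 h9 h10.
apply: (reg r c1 s1); try lia.
- by apply: same_eq h4 _; rewrite /cont /=; lia.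
- by move: h5; rewrite !shiftE.
- by move: h6; rewrite !shiftE.
Qed.

(* Dual to [regular_incr]: the node [p] is now removable and satisfies
   [p <= m <= p + (1, 1)]. *)
Lemma regular_decr s nu r : is_partition nu -> addr nu r ->
  let la := incr_nth nu r in let m := (r.+1, (rw nu r).+1) in
  regular s la ->
  (forall p, p \in removable la -> same p m -> p <> m -> nle s p m ->
     exists q, [/\ q \in addable la, same q m, nle s p q & nle s q m]) ->
  regular s nu.
Proof.
move=> pn hr la m reg hyp; have pl : is_partition la by exact: partition_incr.
have tight p : p \in removable la -> same p m -> p <> m ->
    nle s p m -> nle s m (shift11 p) -> False.
  move=> h1 h2 h3 h4 h5; have [q [q1 q2 q3 q4]] := hyp p h1 h2 h3 h4.
  have qp : same q p by rewrite (same_trans q2) // same_sym.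
  have := regular_window pl reg q1 h1 qp q3.
  by rewrite (nle_trans q4).
have laE j : rw la j = ((r == j) + rw nu j)%N by rewrite nth_incr_nth.
move=> r1 c1 s1 h1 h2 h3 h4 h5 h6.
have hn1 := partition_anti pn (leqnSn r1).
have hns := partition_anti pn (leqnSn s1).
have hnr := partition_anti pn (leqnSn r).
have [h|h] := eqVneq r r1; last first.
  have lar1 : rw la r1 = rw nu r1 by rewrite laE (negbTE h).
  have [h7|h7] := leqP (rw la s1.+1) c1.
    by apply: (reg r1 c1 s1); rewrite ?lar1 // laE; lia.
  (* The removed node stood just below the foot. If row [r1] ends in a removable node, [tight]
     applies; otherwise the next row of [la] is equally long, and lowering arm and foot by one row
     gives a forbidden hook of [la]. *)
  have [h8 h9] : r = s1.+1 /\ c1 = rw nu r.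
    by move: h7; rewrite laE; case: (r =P s1.+1) => [->|_]; lia.
  have lr : (r1 < r)%N.
    rewrite ltnNge; apply/negP => hh; have := partition_anti pn hh; lia.
  have lacr : rw la r = c1.+1 by rewrite laE eqxx; lia.
  have [h10|h10] := boolP (remr la r1).
    apply: (tight (r1.+1, rw la r1)); rewrite /m /shift11 /= -?h9 ?h8 ?lar1.
    + by apply/removableP => //; exists r1 => //; rewrite lar1.
    + by apply: same_eq h4 _; rewrite /cont /=; lia.
    + by case; lia.
    + by move: h6; rewrite !shiftE.
    + by move: h5; rewrite !shiftE.
  have h11 : rw la r1.+1 = rw nu r1.
    by rewrite -lar1; move: h10; rewrite /remr; have := partition_anti pl (leqnSn r1); lia.
  apply: (reg r1.+1 c1 r); rewrite ?h11 ?lacr //.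
  + by rewrite laE; lia.
  + by rewrite h8; apply: same_eq h4 _; rewrite /cont /=; lia.
  + by rewrite h8; move: h5; rewrite !shiftE.
  + by rewrite h8; move: h6; rewrite !shiftE.
move: h1 h4 h5 h6; rewrite -h => h1 h4 h5 h6.
have lar : rw la r = (rw nu r).+1 by rewrite laE eqxx.
have h7 : r != s1.+1 by apply/eqP => hh; move: h3; rewrite -hh; lia.
have h8 : rw la s1.+1 = rw nu s1.+1 by rewrite laE (negbTE h7).
(* The removed node ended the arm. Either the foot is removable and [tight] applies, or the hook one
   column to the right is forbidden in [la]. *)
have [h9|h9] := eqVneq (rw la s1) c1.+1.
  apply: (tight (s1.+1, rw la s1)); rewrite ?h9 /m /shift11 //=.
  - by apply/removableP => //; exists s1; rewrite ?h9 // /remr h8 h9.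
  - by rewrite same_sym.
  - by case; lia.
have h10 : (c1.+1 < rw la s1)%N by move: h9; rewrite laE; lia.
apply: (reg r c1.+1 s1); rewrite ?lar ?h8 //.
- by lia.
- by apply: same_eq h4 _; rewrite /cont /=; lia.
- by move: h5; rewrite !shiftE.
- by move: h6; rewrite !shiftE.
Qed.
End NodeOrder.

(** * Good nodes *)

Arguments addable : simpl never.
Arguments removable : simpl never.
Arguments nodes : simpl never.
Arguments residue : simpl never.

Lemma mem_addable la x : is_partition la ->
  (x \in addable la) = [&& (0 < x.1)%N, x.2 == (rw la x.1.-1).+1 & addr la x.1.-1].
Proof.
move=> pl; apply/addableP/idP => //; first by case=> r hr -> /=; rewrite eqxx.
by case: x => [[|r] c] //= /andP[/eqP-> hr]; exists r.
Qed.

Lemma mem_removable la x : is_partition la ->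
  (x \in removable la) = [&& (0 < x.1)%N, x.2 == rw la x.1.-1 & remr la x.1.-1].
Proof.
move=> pl; apply/removableP/idP => //; first by case=> r hr -> /=; rewrite eqxx.
by case: x => [[|r] c] //= /andP[/eqP-> hr]; exists r.
Qed.

Lemma addable_not_removable la x : is_partition la ->
  x \in addable la -> x \in removable la -> False.
Proof.
move=> pl; rewrite mem_addable // mem_removable //.
by move=> /and3P[_ /eqP-> _] /and3P[_ /eqP]; lia.
Qed.

Lemma uniq_addable la : uniq (addable la).
Proof.
by rewrite map_inj_in_uniq ?filter_uniq ?iota_uniq // => r t _ _ [].
Qed.

Lemma uniq_removable la : uniq (removable la).
Proof.
by rewrite map_inj_in_uniq ?filter_uniq ?iota_uniq // => r t _ _ [].
Qed.

Section GoodNodes.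
Variables (e z : nat) (a : int).
Hypotheses (ez0 : (0 < e * z)%N) (e2 : (2 <= e)%N).
Implicit Types (i : int) (la mu nu : seq nat).
Local Notation nle := (nle e z a).
Local Notation lev := (lev e z a).
Local Notation same := (same e).
Local Notation regular := (regular e z a).

Definition presig i la : sword :=
  [seq (x, true) | x <- addable la & residue e x == i] ++
  [seq (x, false) | x <- removable la & residue e x == i].
Definition sig s i la : sword := sort (fun p q => nle s q.1 p.1) (presig i la).

Lemma mem_sig s i la x b : ((x, b) \in sig s i la) =
  (residue e x == i) && (x \in if b then addable la else removable la).
Proof.
rewrite mem_sort mem_cat; apply/orP/andP.
  by case=> /mapP[y]; rewrite mem_filter => /andP[h1 h2] [-> ->].
case: b => -[h1 h2]; [left|right]; apply/mapP; exists x => //.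
  by rewrite mem_filter h1.
by rewrite mem_filter h1.
Qed.

Lemma sig_pairwise s i la : pairwise (fun p q => nle s q.1 p.1) (sig s i la).
Proof.
rewrite -sorted_pairwise; last by move=> p q r h1 h2; apply: nle_trans h2 h1.
by apply: sort_sorted => p q; apply: nle_total.
Qed.

Lemma uniq_sig_nodes s i la : is_partition la -> uniq (map fst (sig s i la)).
Proof.
move=> pl; have /perm_map/perm_uniq-> : perm_eq (sig s i la) (presig i la).
  by rewrite perm_sort.
rewrite map_cat -!map_comp !(@eq_map _ _ (_ \o _) id) // !map_id cat_uniq.
rewrite !filter_uniq ?uniq_addable ?uniq_removable // andbT.
apply/hasPn => x; rewrite mem_filter => /andP[_ h].
apply/negP; rewrite mem_filter => /andP[_ h1]; apply: (addable_not_removable pl h1 h).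
Qed.

Lemma good_mem b w u p v : good b w u p v -> (p.1, b) \in w.
Proof.
by case=> -> <- _ _; rewrite mem_cat inE -surjective_pairing eqxx orbT.
Qed.

Lemma good_order s i la b u p v : good b (sig s i la) u p v ->
  [/\ forall q, q \in u -> nle s p.1 q.1, forall q, q \in v -> nle s q.1 p.1,
      pairwise (fun p q => nle s q.1 p.1) u & pairwise (fun p q => nle s q.1 p.1) v].
Proof.
move=> [h _ _ _]; have := sig_pairwise s i la.
rewrite h pairwise_cat /= => /and3P[/allrelP h1 h2 /andP[/allP h3 h4]].
by split=> // q hq; apply: h1 => //; rewrite inE eqxx.
Qed.

Lemma good_cases s i la b u p v (q : nat * nat) c : is_partition la ->
  good b (sig s i la) u p v -> (q, c) \in sig s i la -> q <> p.1 ->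
  (nle s p.1 q -> (q, c) \in u) /\ (nle s q p.1 -> (q, c) \in v).
Proof.
move=> pl h; have [h1 h2 _ _] := good_order h.
case: h => -> _ _ _; rewrite mem_cat inE => /or3P[hq|/eqP<-|hq] // qp.
  split=> // h3; have := h1 _ hq => /= h4.
  by case: qp; apply: (@nle_anti e z a ez0 s); rewrite h3 h4.
split=> // h3; have := h2 _ hq => /= h4.
by case: qp; apply: (@nle_anti e z a ez0 s); rewrite h3 h4.
Qed.

(** An addable [q] above the good node stands in [u]. The suffix of [u] from [q] on has at least as
    many - as +, hence a - after [q]; this is the removable node that [regular_incr] asks for. *)
Lemma good_plus_incr s i la u p v : is_partition la -> regular s la ->
  good true (sig s i la) u p v ->
  exists r, [/\ addr la r, p.1 = (r.+1, (rw la r).+1) & regular s (incr_nth la r)].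
Proof.
move=> pl reg h; have := good_mem h; rewrite mem_sig => /andP[/eqP hi].
move=> /(addableP _ pl)[r hr er]; exists r; split=> //.
apply: regular_incr => // q; rewrite -er => h1 h2 h3 h4.
have hq : (q, true) \in sig s i la by rewrite mem_sig h1 (eqP h2) hi eqxx.
have [hu _] := good_cases pl h hq h3; have {}hu := hu h4.
have [k1 _ k3 _] := good_order h; case: h => hw hp hu' _.
case/splitPr: hu hw k1 k3 hu' => u1 u2 hw k1 k3 hu'.
have := plus_matched_le (plus_matched_cat hu'); rewrite !nE /= => h5.
have : has (fun p => ~~ p.2) u2 by rewrite has_count -/(nmi u2); lia.
case/hasP => -[x b] hx /= /negbTE hb; rewrite hb in hx.
have : (x, false) \in sig s i la by rewrite hw !(mem_cat, inE) hx !orbT.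
rewrite mem_sig => /andP[/eqP hx1 hx2]; exists x; split=> //.
- by rewrite /same hx1 hi.
- by apply: (k1 (x, false)); rewrite mem_cat inE hx !orbT.
- move: k3; rewrite pairwise_cat /= => /and3P[_ _ /andP[/allP k3 _]].
  exact: (k3 _ hx).
Qed.

(** Adding a node affects the boundary only at that node and its four neighbours, whose residues
    differ from its own because [e] is at least 2. *)
Lemma mem_incr nu r x : is_partition nu -> addr nu r ->
  let la := incr_nth nu r in let m := (r.+1, (rw nu r).+1) in
  same x m -> x != m ->
  ((x \in addable la) = (x \in addable nu)) *
  ((x \in removable la) = (x \in removable nu)).
Proof.
move=> pn hr la m hs hx; have pl : is_partition la by exact: partition_incr.
rewrite !mem_addable // !mem_removable //.
have n1 : x != (r.+1, (rw nu r).+2).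
  by apply/eqP => hh; move: hs; rewrite hh same_next_col //.
have n2 : x != (r.+2, (rw nu r).+1).
  by apply/eqP => hh; move: hs; rewrite hh same_next_row //.
have n3 : x != (r.+1, rw nu r).
  by apply/eqP => hh; move: hs; rewrite hh same_sym same_next_col //.
have n4 : x != (r, (rw nu r).+1).
  by apply/eqP => hh; move: hs; rewrite hh same_sym same_next_row //.
case: x hs hx n1 n2 n3 n4 => [[|j] c] //= _.
rewrite /m !xpair_eqE /addr /remr !nth_incr_nth /=.
have h1 := partition_anti pn (leqnSn j).
case: j h1 => [|j] h1 /=; rewrite ?nth_incr_nth.
  move=> h3 h4 h5 h6 h7; move: h3 h4 h5 h6 h7.
  case: r hr {la m pl} => [|[|r]] /=; rewrite /addr /=; split; lia.
move: hr; rewrite /addr; have h2 := partition_anti pn (leqnSn j).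
have [->|n1] := eqVneq r j.+1; first by split; lia.
have [->|n2] := eqVneq r j; first by split; lia.
have [->|n3] := eqVneq r j.+2; first by split; lia.
by split; lia.
Qed.

Definition inodes i la : seq (nat * nat) := map fst (presig i la).

Lemma sig_nodes s i la :
  map fst (sig s i la) = sort (fun x y => nle s y x) (inodes i la).
Proof. by rewrite /sig /inodes sort_map. Qed.

Lemma mem_inodes i la x : (x \in inodes i la) =
  (residue e x == i) && ((x \in addable la) || (x \in removable la)).
Proof.
rewrite /inodes /presig map_cat -!map_comp mem_cat.
rewrite !(eq_map (g := id)) // !map_id !mem_filter.
by case: (_ == _).
Qed.

Lemma uniq_inodes i la : is_partition la -> uniq (inodes i la).
Proof. by move=> pl; have := uniq_sig_nodes true i pl; rewrite sig_nodes sort_uniq. Qed.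

Lemma sig_eq_map s i la : is_partition la ->
  sig s i la = [seq (x, x \in addable la) | x <- map fst (sig s i la)].
Proof.
move=> pl; rewrite -map_comp -[LHS]map_id; apply/eq_in_map => -[x b] /=.
rewrite mem_sig => /andP[_]; case: b => [->|h] //=; congr pair.
by apply/esym/negbTE/negP => h1; apply: (addable_not_removable pl h1 h).
Qed.

Lemma incr_addable nu r : is_partition nu -> addr nu r ->
  (r.+1, (rw nu r).+1) \in addable nu.
Proof. by move=> pn hr; apply/addableP => //; exists r. Qed.

Lemma incr_removable nu r : is_partition nu -> addr nu r ->
  (r.+1, (rw nu r).+1) \in removable (incr_nth nu r).
Proof.
move=> pn hr; apply/removableP; first exact: partition_incr.
have := partition_anti pn (leqnSn r).
by exists r; rewrite /remr !nth_incr_nth eqxx //; case: eqP; lia.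
Qed.

(** By [mem_incr] the boundary nodes of residue [i] are the same for both partitions, so the sorted
    lists of nodes agree and only the sign at [p] flips. *)
Lemma sig_decr s i nu r u p v : is_partition nu -> addr nu r ->
  p.1 = (r.+1, (rw nu r).+1) ->
  sig s i (incr_nth nu r) = u ++ p :: v -> sig s i nu = u ++ (p.1, true) :: v.
Proof.
move=> pn hr ep h; have pl := partition_incr pn hr.
have ma := incr_addable pn hr; have mr := incr_removable pn hr.
rewrite -ep in ma mr.
have hi : residue e p.1 = i.
  have : p \in sig s i (incr_nth nu r) by rewrite h mem_cat inE eqxx orbT.
  by case: (p) => x b; rewrite mem_sig => /andP[/eqP].
have hm x : residue e x = i -> x != p.1 ->
    ((x \in addable (incr_nth nu r)) = (x \in addable nu)) *
    ((x \in removable (incr_nth nu r)) = (x \in removable nu)).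
  by rewrite ep => hx; apply: mem_incr => //; rewrite /same hx -ep hi.
have hp : perm_eq (inodes i nu) (inodes i (incr_nth nu r)).
  apply: uniq_perm; rewrite ?uniq_inodes // => x; rewrite !mem_inodes.
  have [hx|] := eqVneq (residue e x) i => //=.
  have [->|hxp] := eqVneq x p.1; first by rewrite ma mr orbT.
  by rewrite !hm.
rewrite (sig_eq_map s i pn) sig_nodes.
have -> : sort (fun x y => nle s y x) (inodes i nu) = map fst (u ++ p :: v).
  rewrite -h sig_nodes; apply/perm_sortP => //.
  - by move=> x y; apply: nle_total.
  - by move=> x y w h1 h2; apply: nle_trans h2 h1.
  - by move=> x y h1; apply: (@nle_anti e z a ez0 s); rewrite andbC.
have /= hu := uniq_sig_nodes s i pl; rewrite h map_cat /= -cat1s uniq_catCA /= in hu.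
case/andP: hu => hu _.
have hmap (w : sword) : {subset w <= u ++ v} ->
    [seq (x, x \in addable nu) | x <- map fst w] = w.
  move=> hw; rewrite -map_comp -[RHS]map_id; apply/eq_in_map => -[x b] /= hx.
  have hin : (x, b) \in sig s i (incr_nth nu r).
    by have := hw _ hx; rewrite h !mem_cat inE => /orP[->|->]; rewrite ?orbT.
  have hxp : x != p.1.
    apply: contraNneq hu => <-; have := hw _ hx.
    by rewrite -map_cat => hx'; apply/mapP; exists (x, b).
  have -> : b = (x \in addable (incr_nth nu r)).
    by move: hin; rewrite (sig_eq_map s i pl) => /mapP[y _ [-> ->]].
  by move: hin; rewrite mem_sig => /andP[/eqP hx1 _]; rewrite hm.
rewrite map_cat map_cat /= ma !hmap //.
  by move=> x; rewrite mem_cat orbC => ->.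
by move=> x; rewrite mem_cat => ->.
Qed.

(** Dual to [good_plus_incr]: a removable [q] below the good node stands in [v], where its - is
    matched by an earlier +, the node that [regular_decr] asks for. The factorisation survives with
    the sign of [p] flipped, so adding the node back is the crystal operator. *)
Lemma good_minus_decr s i la u p v : is_partition la -> regular s la ->
  good false (sig s i la) u p v ->
  exists nu r, 
    [/\ la = incr_nth nu r, p.1 = (r.+1, (rw nu r).+1), addr nu r & is_partition nu] /\
    regular s nu /\ good true (sig s i nu) u (p.1, true) v.
Proof.
move=> pl reg h; have := good_mem h; rewrite mem_sig => /andP[/eqP hi].
move=> /(removableP _ pl)[r hr er].
have [nu [pn el hn]] := partition_decr pl hr.
have ep : p.1 = (r.+1, (rw nu r).+1) by rewrite er el nth_incr_nth eqxx.
exists nu, r; split=> //; split; last first.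
  case: h => h hp hu hv; split=> //.
  by apply: (sig_decr (r := r)) => //; rewrite -el h.
apply: (@regular_decr e z a ez0 e2 s nu r) => //; rewrite -el // -ep.
move=> q h1 h2 h3 h4.
have hq : (q, false) \in sig s i la by rewrite mem_sig h1 (eqP h2) hi eqxx.
have [_ hu] := good_cases pl h hq h3; have {}hu := hu h4.
have [_ k1 _ k3] := good_order h; case: h => hw hp _ hv'.
case/splitPr: hu hw k1 k3 hv' => v1 v2 hw k1 k3 hv'.
have := minus_matched_cat (_ : minus_matched 0 ((v1 ++ [:: (q, false)]) ++ v2)).
rewrite -catA => /(_ hv')[_ h5 _].
move: h5; rewrite !nE /= => h5.
have : has (fun p => p.2) v1.
  by rewrite has_count; move: h5; rewrite /npl /nmi /=; lia.
case/hasP => -[x b] hx /= hb; rewrite hb in hx.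
have : (x, true) \in sig s i la by rewrite hw !(mem_cat, inE) hx !orbT.
rewrite mem_sig => /andP[/eqP hx1 hx2]; exists x; split=> //.
- by rewrite /same hx1 hi.
- move: k3; rewrite pairwise_cat /= => /and3P[/allrelP k3 _ _].
  by apply: (k3 (x, true) (q, false)); rewrite ?inE ?eqxx.
- by apply: (k1 (x, true)); rewrite mem_cat hx.
Qed.
End GoodNodes.

(** * The ladder of the good node *)

Section Heights.
Variables (e z : nat) (a : int).
Hypotheses (ez0 : (0 < e * z)%N) (e2 : (2 <= e)%N).
Hypotheses (a0 : 0 < a) (aez : a < (e * z)%:Z).
Implicit Types (s : bool) (i x : int) (la mu nu : seq nat) (w u v : sword).
Local Notation nle := (nle e z a).
Local Notation lev := (lev e z a).
Local Notation regular := (regular e z a).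
Local Notation sig := (sig e z a).
Local Notation E := (e * z)%:Z.

Definition cplus x w : nat := count (fun p => p.2 && (x < lev p.1)) w.
Definition cminus x w : nat := count (fun p => ~~ p.2 && (x < lev p.1 + E)) w.

(* Removable nodes are counted at [m + (1, 1)]; this makes the difference
   depend only on the ladder content, see [height_equiv]. *)
Definition height i la x : int :=
  (count (fun n => (residue e n == i) && (x < lev n)) (addable la))%:Z -
  (count (fun m => (residue e m == i) && (x < lev m + E)) (removable la))%:Z.

Lemma height_sig s i la x :
  height i la x = (cplus x (sig s i la))%:Z - (cminus x (sig s i la))%:Z.
Proof.
have hp : perm_eq (sig s i la) (presig e i la) by rewrite perm_sort.
rewrite /cplus /cminus !(seq.permP hp) /presig !count_cat !count_map !count_filter.
rewrite /height; congr (_%:Z - _%:Z).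
  rewrite [X in (_ + X)%N](@eq_count _ _ pred0) // count_pred0 addn0.
  by apply: eq_count => n /=; rewrite andbC.
rewrite [X in (X + _)%N](@eq_count _ _ pred0) // count_pred0 add0n.
by apply: eq_count => n /=; rewrite andbC.
Qed.

Definition windowed s w : Prop := forall n m,
  (n, true) \in w -> (m, false) \in w -> nle s m n -> nle s (shift11 m) n.

Lemma sig_windowed s i la : is_partition la -> regular s la -> windowed s (sig s i la).
Proof.
move=> pl reg n m; rewrite !mem_sig => /andP[/eqP h1 h2] /andP[/eqP h3 h4] h5.
have nm : same e n m by rewrite /same h1 h3.
have := regular_window ez0 e2 pl reg h2 h4 nm h5.
by have /orP[->|->] := @nle_total e z a s n (shift11 m).
Qed.

Notation desc s w := (pairwise (fun p q => nle s q.1 p.1) w).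

Lemma cminus_le x w : (cminus x w <= nmi w)%N.
Proof. by apply: sub_count => p /andP[]. Qed.
Lemma cplus_le x w : (cplus x w <= npl w)%N.
Proof. by apply: sub_count => p /andP[]. Qed.

Lemma lev_window s w n m : windowed s w -> (n, true) \in w -> (m, false) \in w ->
  nle s m n -> lev m + E <= lev n.
Proof.
move=> hw h1 h2 h3; rewrite -lev_shift11; apply: (@nle_lev e z a s).
exact: hw.
Qed.

(** If the last letter is a counted -, the window condition puts every + before it high enough to be
    counted too, and the bound reduces to the total numbers of letters. *)
Lemma minus_matched_height s x v : windowed s v -> desc s v ->
  minus_matched 0 v -> (cminus x v <= cplus x v)%N.
Proof.
elim/last_ind: v => [|v [b c] IH] //.
rewrite -cats1 => hw; rewrite pairwise_cat => /and3P[/allrelP h1 h2 _] h3.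
have [h4 _ _] := minus_matched_cat h3; have h5 := minus_matched_le h3.
have {}IH : (cminus x v <= cplus x v)%N.
  by apply: IH => // n m hn hm; apply: hw; rewrite mem_cat ?hn ?hm.
rewrite /cminus /cplus !count_cat /= -/(cminus x v) -/(cplus x v) !addn0.
case: c hw h1 h3 h5 => hw h1 h3 h5 /=; first by lia.
case h6 : (x < lev b + E); last by lia.
have -> : cplus x v = npl v.
  apply: eq_in_count => -[n []] //= hn.
  have := h1 (n, true) (b, false) hn (mem_head _ _) => /= h7.
  have : lev b + E <= lev n.
    by apply: (lev_window hw) h7; rewrite mem_cat ?hn // inE eqxx orbT.
  by lia.
move: h5; rewrite !nE /=; have := cminus_le x v; rewrite /npl /nmi /=; lia.
Qed.

(** This is the complementary bound: among the letters not counted, + are at most as many as -. If a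
    leading + is not counted, the window condition leaves no - after it counted. *)
Lemma plus_matched_height s x u : windowed s u -> desc s u -> plus_matched u ->
  (npl u + cminus x u <= nmi u + cplus x u)%N.
Proof.
elim: u => [|[b c] u IH] // hw /= /andP[/allP h1 h2] /andP[h3 h4].
have {}IH : (npl u + cminus x u <= nmi u + cplus x u)%N.
  by apply: IH => // n m hn hm; apply: hw; rewrite inE ?hn ?hm orbT.
move: h3; rewrite /cplus /cminus /= -/(cminus x u) -/(cplus x u) !nE.
case: c hw h1 => hw h1 /= h3; last by lia.
case h6 : (x < lev b); first by lia.
have -> : cminus x u = 0%N.
  apply/eqP; rewrite -leqn0 leqNgt -has_count; apply/hasPn => -[m []] //= hm.
  have : lev m + E <= lev b.
    by apply: (lev_window hw); rewrite ?inE ?eqxx ?hm ?orbT //; apply: (h1 _ hm).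
  by lia.
by lia.
Qed.

Section Good.
Variables (s : bool) (i : int) (la : seq nat) (b : bool) (u v : sword).
Variable p : (nat * nat) * bool.
Hypotheses (pl : is_partition la) (reg : regular s la).
Hypothesis hg : good b (sig s i la) u p v.

(** The letters of [u] contribute at least their total surplus, those of [v] at least 0, and the
    conditional term is the contribution of [p]. *)
Lemma good_height_ge x : (npl u)%:Z - (nmi u)%:Z +
  (if b then (if x < lev p.1 then 1 else 0)
   else if x < lev p.1 + E then -1 else 0) <= height i la x.
Proof.
have hw : windowed s (sig s i la) by exact: sig_windowed.
have [_ _ h3 h4] := good_order hg.
rewrite (height_sig s); case: hg => hs hb hu hv; rewrite hs in hw *.
have wu : windowed s u.
  by move=> n m hn hm; apply: hw; rewrite mem_cat ?hn ?hm.
have wv : windowed s v.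
  by move=> n m hn hm; apply: hw; rewrite mem_cat inE ?hn ?hm !orbT.
have := minus_matched_height x wv h4 hv.
have := plus_matched_height x wu h3 hu.
rewrite /cplus /cminus !count_cat /= hb.
rewrite -/(cplus x u) -/(cminus x u) -/(cplus x v) -/(cminus x v).
by case: (b) => /=; case: (x < _) => /=; lia.
Qed.

(** The smallest minimiser of [height] if [b] holds, the largest otherwise. In the second case it is
    the last integer below the shifted level of [p]. *)
Definition pivot : int := if b then lev p.1 else lev p.1 + E - 1.

(** At the pivot no + of [v] is counted and every - of [u] is, so the lower bound of
    [good_height_ge] is attained. *)
Lemma good_height_pivot :
  height i la pivot <= (npl u)%:Z - (nmi u)%:Z - (if b then 0 else 1).
Proof.
have hw : windowed s (sig s i la) by exact: sig_windowed.
have [h1 h2 h3 h4] := good_order hg.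
rewrite (height_sig s); case: hg => hs hb hu hv; rewrite hs in hw *.
have wv : windowed s v.
  by move=> n m hn hm; apply: hw; rewrite mem_cat inE ?hn ?hm !orbT.
have hp : (pivot < if b then lev p.1 else lev p.1 + E) = ~~ b.
  by rewrite /pivot; case: (b); lia.
have hc := minus_matched_height pivot wv h4 hv.
have := cplus_le pivot u.
have e0 : cplus pivot v = 0%N.
  apply/eqP; rewrite -leqn0 leqNgt -has_count; apply/hasPn => q hq.
  rewrite negb_and -leNgt; apply/orP; right.
  by apply: le_trans (nle_lev (h2 _ hq)) _; rewrite /pivot; case: (b); lia.
have e1 : cminus pivot u = nmi u.
  apply: eq_in_count => q hq.
  suff -> : pivot < lev q.1 + E by rewrite andbT.
  apply: lt_le_trans (_ : lev p.1 + E <= _); first by rewrite /pivot; case: (b); lia.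
  by rewrite lerD2r; apply: nle_lev (h1 _ hq).
rewrite /cplus /cminus !count_cat /= hb.
rewrite -/(cplus pivot u) -/(cminus pivot u) -/(cplus pivot v) -/(cminus pivot v) e0 e1.
by move: hc hp; rewrite e0; case: (b) => /= hc ->; lia.
Qed.

Lemma pivot_min x : height i la pivot <= height i la x.
Proof.
have := good_height_pivot; have := good_height_ge x.
by case: (b); case: (x < _); lia.
Qed.

Lemma pivot_strict x : (if b then x < pivot else pivot < x) ->
  height i la pivot < height i la x.
Proof.
have := good_height_pivot; have := good_height_ge x.
move: (height i la pivot) (height i la x) => h1 h2; rewrite /pivot.
by case: (b); case: ltP; lia.
Qed.
End Good.

Lemma lev_ge0 q : 0 <= lev q.
Proof. by rewrite levE; nia. Qed.

(* Existence and level of the good node are read off from the minima of the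
   common height function. *)
Lemma good_transfer s t i la mu b u p v :
  is_partition la -> is_partition mu -> regular s la -> regular t mu ->
  (forall x, height i la x = height i mu x) ->
  good b (sig s i la) u p v ->
  exists u' p' v', good b (sig t i mu) u' p' v' /\ lev p'.1 = lev p.1.
Proof.
move=> pl pm rl rm hh hg.
suff [u' [p' [v' hg']]] : exists u' p' v', good b (sig t i mu) u' p' v'.
  exists u', p', v'; split=> //.
  have h1 := pivot_min pl rl hg (pivot b p').
  have h2 := pivot_min pm rm hg' (pivot b p).
  have h3 := @pivot_strict _ _ _ _ _ _ _ pl rl hg (pivot b p').
  have h4 := @pivot_strict _ _ _ _ _ _ _ pm rm hg' (pivot b p).
  move: h1 h2 h3 h4; rewrite !hh /pivot.
  case: (b) => h1 h2 h3 h4.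
    have n3 : ~ (lev p'.1 < lev p.1) by move=> h; have := h3 h; lia.
    have n4 : ~ (lev p.1 < lev p'.1) by move=> h; have := h4 h; lia.
    by lia.
  have n3 : ~ (lev p.1 + E - 1 < lev p'.1 + E - 1) by move=> h; have := h3 h; lia.
  have n4 : ~ (lev p'.1 + E - 1 < lev p.1 + E - 1) by move=> h; have := h4 h; lia.
  by lia.
have wm : windowed t (sig t i mu) by exact: sig_windowed.
 have dm := sig_pairwise e z a t i mu.
case: b hg => hg.
  case: (plus_matched_or_good (sig t i mu)) => // hm.
  have := plus_matched_height (pivot true p) wm dm hm.
  have := height_sig t i mu (pivot true p); have := height_sig t i mu (-1).
  (* Levels are nonnegative, so at [-1] every letter is counted and the height is the total surplus
     of +. By [pivot_strict] it exceeds the height at the pivot, while matching every + gives the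
     opposite inequality. *)
  have -> : cplus (-1) (sig t i mu) = npl (sig t i mu).
    by apply: eq_count => q /=; have := lev_ge0 q.1; lia.
  have -> : cminus (-1) (sig t i mu) = nmi (sig t i mu).
    by apply: eq_count => q /=; have := lev_ge0 q.1; lia.
  have := @pivot_strict _ _ _ _ _ _ _ pl rl hg (-1); rewrite !hh /pivot.
  by have := lev_ge0 p.1; lia.
(* With every - matched the height would be nonnegative at the pivot of [la], where
   [good_height_pivot] bounds it by -1. *)
case: (minus_matched_or_good (sig t i mu)) => // hm.
have := minus_matched_height (pivot false p) wm dm hm.
have := height_sig t i mu (pivot false p).
have := good_height_pivot pl rl hg; rewrite hh.
by case: hg => _ _ /plus_matched_le; lia.
Qed.

Lemma max_upto (f : nat -> int) n : (0 < n)%N ->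
  exists2 j, (j < n)%N & forall k, (k < n)%N -> f k <= f j.
Proof.
elim: n => // -[|n] IH _.
  by exists 0%N => // k; rewrite ltnS leqn0 => /eqP->.
have [//|j hj h] := IH; have [h1|h1] := lerP (f n.+1) (f j).
  exists j; first by lia.
  by move=> k; rewrite ltnS leq_eqVlt => /orP[/eqP->|/h].
exists n.+1 => // k; rewrite ltnS leq_eqVlt => /orP[/eqP->//|/h]; lia.
Qed.

(* A removable node [m] of maximal level is normal: every addable node has
   level less than that of [m + (1, 1)]. *)
Lemma nonempty_good s la : is_partition la -> regular s la -> la != [::] ->
  exists i u p v, good false (sig s i la) u p v.
Proof.
move=> pl reg la0; have sz : (0 < size la)%N by case: (la) la0.
have [j hj hmax] := max_upto (fun j => lev (j.+1, rw la j)) sz.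
have lcol r c d : (c <= d)%N -> lev (r, c) <= lev (r, d).
  by move=> cd; rewrite !levE /=; nia.
have hrem : remr la j.
  have := partition_anti pl (leqnSn j); rewrite /remr leq_eqVlt => /orP[/eqP h|//].
  have := partition_size j pl; rewrite hj => /esym h1.
  have := hmax j.+1; rewrite (partition_size j.+1 pl) h => /(_ h1).
  by rewrite lev_row; lia.
(* In the first row the addable node gains [E - a] over the end of the row; elsewhere it lies below
   a node of the diagram and gains [a] over it. Both gains are less than [E]. *)
have hadd n : n \in addable la -> lev n < lev (j.+1, rw la j) + E.
  case/(addableP _ pl) => -[|r] hr ->.
    by rewrite lev_col; have := hmax 0%N sz; lia.
  move: hr; rewrite /addr /= => hr; rewrite lev_row.
  have hr' : (r < size la)%N by rewrite partition_size //; lia.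
  by have := hmax r hr'; have := lcol r.+1 _ _ hr; lia.
set m := (j.+1, rw la j) in hadd; exists (residue e m).
case: (minus_matched_or_good (sig s (residue e m) la)) => // hm.
have hw : windowed s (sig s (residue e m) la) by exact: sig_windowed.
have := minus_matched_height (lev m + E - 1) hw (sig_pairwise e z a s _ la) hm.
have -> : cplus (lev m + E - 1) (sig s (residue e m) la) = 0%N.
  apply/eqP; rewrite -leqn0 leqNgt -has_count; apply/hasPn => -[n []] //=.
  by rewrite mem_sig => /andP[_ /hadd]; lia.
rewrite leqn0 => /eqP h.
have : has (fun p => ~~ p.2 && (lev m + E - 1 < lev p.1 + E)) (sig s (residue e m) la).
  apply/hasP; exists (m, false); last by rewrite /=; lia.
  by rewrite mem_sig eqxx /=; apply/removableP => //; exists j.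
by rewrite has_count -/(cminus _ _) h.
Qed.
End Heights.

(** * Ladder equivalence *)

Lemma big_iota1 (F : nat -> int) n :
  \sum_(r <- iota 1 n) F r = \sum_(0 <= r < n) F r.+1.
Proof. by rewrite (iotaDl 1 0) big_map /index_iota subn0. Qed.

Lemma sum_addable (f : nat * nat -> int) la : \sum_(x <- addable la) f x =
  \sum_(0 <= r < (size la).+1) if addr la r then f (r.+1, (rw la r).+1) else 0.
Proof.
rewrite /addable big_map big_filter big_mkcond big_iota1.
by apply: eq_bigr => -[|r].
Qed.

Lemma sum_removable (f : nat * nat -> int) la : \sum_(x <- removable la) f x =
  \sum_(0 <= r < size la) if remr la r then f (r.+1, rw la r) else 0.
Proof. by rewrite /removable big_map big_filter big_mkcond big_iota1. Qed.

Lemma sum_nodes (f : nat * nat -> int) la : \sum_(x <- nodes la) f x =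
  \sum_(0 <= r < size la) \sum_(0 <= c < rw la r) f (r.+1, c.+1).
Proof.
rewrite /nodes big_flatten big_map big_iota1.
by apply: eq_bigr => r _; rewrite big_map big_iota1.
Qed.

(** Summation by parts in both directions: the mixed second difference of [f], summed over a Young
    diagram, leaves only the corner and the boundary terms. *)
Lemma sum_boundary (f : nat * nat -> int) la : is_partition la ->
  \sum_(x <- addable la) f x - \sum_(x <- removable la) f (shift11 x) =
  f (1%N, 1%N) - \sum_(x <- nodes la)
     (f x - f (x.1.+1, x.2) - f (x.1, x.2.+1) + f (shift11 x)).
Proof.
move=> pl; rewrite sum_addable sum_removable sum_nodes /=.
have -> : \sum_(0 <= r < size la) \sum_(0 <= c < rw la r)
    (f (r.+1, c.+1) - f (r.+2, c.+1) - f (r.+1, c.+2) + f (shift11 (r.+1, c.+1)))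
  = \sum_(0 <= r < size la) (f (r.+2, (rw la r).+1) - f (r.+1, (rw la r).+1)
      - (f (r.+2, 1%N) - f (r.+1, 1%N))).
  apply: eq_bigr => r _.
  rewrite -(telescope_sumr (fun c => f (r.+2, c.+1) - f (r.+1, c.+1))) //.
  by apply: eq_bigr => c _; rewrite /shift11 /=; ring.
(* Truncated to [n] rows the identity has two extra terms, which cancel at [n = size la] because
   that row has length 0. *)
suff main n : \sum_(0 <= r < n.+1) (if addr la r then f (r.+1, (rw la r).+1) else 0)
    - \sum_(0 <= r < n) (if remr la r then f (shift11 (r.+1, rw la r)) else 0)
  = f (1%N, 1%N) - \sum_(0 <= r < n) (f (r.+2, (rw la r).+1) - f (r.+1, (rw la r).+1)
      - (f (r.+2, 1%N) - f (r.+1, 1%N))) + f (n.+1, (rw la n).+1) - f (n.+1, 1%N).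
  by rewrite main nth_default //; ring.
elim: n => [|n IH].
  by rewrite big_nat1 !big_nil /addr /=; ring.
rewrite big_nat_recr // [X in _ - X]big_nat_recr //= [in RHS]big_nat_recr //=.
move: IH; set S1 := \sum_(0 <= r < n.+1) _; set S2 := \sum_(0 <= r < n) _.
set S3 := \sum_(0 <= r < n) _ => IH.
rewrite /addr /remr /shift11 /=; case: ltnP => h.
  rewrite [LHS](_ : _ = S1 - S2 + (f (n.+2, (rw la n.+1).+1) - f (n.+2, (rw la n).+1))).
    by rewrite IH; ring.
  by ring.
have -> : rw la n.+1 = rw la n.
  by have := partition_anti pl (leqnSn n); lia.
by rewrite !addr0 IH; ring.
Qed.

Lemma count_sum (T : Type) (P : pred T) s :
  (count P s)%:Z = \sum_(x <- s) (P x : nat)%:Z.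
Proof.
elim: s => [|x s IH]; first by rewrite big_nil.
by rewrite big_cons /= PoszD IH.
Qed.

Lemma mem_nodes la x : is_partition la ->
  (x \in nodes la) = [&& (0 < x.1)%N, (0 < x.2)%N & (x.2 <= rw la x.1.-1)%N].
Proof.
move=> pl; apply/flatten_mapP/idP => [[r]|].
  rewrite mem_iota => hr /mapP[c]; rewrite mem_iota => hc -> /=.
  by rewrite /part_row in hc; lia.
case: x => [[|r] c] //= /andP[c0 hc]; exists r.+1.
  by rewrite mem_iota; have := partition_size r pl; lia.
by apply/mapP; exists c => //; rewrite mem_iota /part_row /=; lia.
Qed.

Lemma uniq_nodes la : uniq (nodes la).
Proof.
apply: allpairs_uniq_dep; rewrite ?iota_uniq //.
  by move=> *; rewrite iota_uniq.
by move=> [r c] [r' c'] _ _ /= [-> ->].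
Qed.

Lemma nodes_incr nu r : is_partition nu -> addr nu r ->
  perm_eq (nodes (incr_nth nu r)) ((r.+1, (rw nu r).+1) :: nodes nu).
Proof.
move=> pn hr; have pl := partition_incr pn hr.
apply: uniq_perm; rewrite /= ?uniq_nodes ?andbT //.
  by rewrite mem_nodes //= ltnn.
case=> [j c]; rewrite inE !mem_nodes //= xpair_eqE.
case: j => [|j] //=; rewrite nth_incr_nth eqSS eq_sym.
by case: eqP => [->|_] /=; lia.
Qed.

Section Ladders.
Variables (e z : nat) (a : int).
Hypotheses (e2 : (2 <= e)%N) (z0 : (0 < z)%N) (az : coprimez a z).
Local Notation E := (e * z)%:Z.
Implicit Types (la mu nu : seq nat) (x y p q : nat * nat).

Definition key x : int * int := (lev e z a x, residue e x).

(** For the converse, if the contents differ by [e t], equal levels make [z] times the column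
    difference equal to [a t]. Since [a] and [z] are coprime, [z] divides [t], and the quotient is
    the ladder parameter. *)
Lemma in_ladderP p q : in_ladder E a p q <-> key q = key p.
Proof.
split=> [[k [h1 h2]]|[h1 /eqP h2]].
  congr pair; first by rewrite /lev h1 h2; ring.
  apply/eqP; rewrite -/(same e q p) sameE /cont h1 h2; apply/dvdzP.
  by exists (k * z%:Z); rewrite PoszM; ring.
move: h2; rewrite -/(same e q p) sameE => /dvdzP[t ht].
move: h1 ht; rewrite /lev /cont => h1 ht.
have h3 : z%:Z * (q.2%:Z - p.2%:Z) = a * t.
  apply: (@mulfI _ e%:Z); first by lia.
  have : a * (q.1%:Z - p.1%:Z) + (E - a) * (q.2%:Z - p.2%:Z) = 0 by lia.
  rewrite (_ : q.1%:Z - p.1%:Z = (q.2%:Z - p.2%:Z) - t * e%:Z); last by lia.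
  by rewrite PoszM => h4; rewrite -[LHS]addr0 -[X in _ + X = _]oppr0 -h4; ring.
have : (z %| a * t)%Z by rewrite -h3 dvdz_mulr.
rewrite Gauss_dvdzr 1?coprimez_sym // => /dvdzP[k hk]; exists k.
have h4 : q.2%:Z - p.2%:Z = k * a.
  by apply: (@mulfI _ z%:Z); [lia | rewrite h3 hk; ring].
split; last by lia.
rewrite (_ : q.1%:Z = p.1%:Z + ((q.2%:Z - p.2%:Z) - t * e%:Z)); last by lia.
by rewrite h4 hk PoszM; ring.
Qed.

Lemma ladder_countE p la :
  ladder_count E a p la = count (fun q => key q == key p) (nodes la).
Proof.
apply: eq_count => q; case: excluded_middle_informative => h.
  by apply/esym/eqP/in_ladderP.
by apply/esym/negbTE/eqP => /in_ladderP.
Qed.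

Lemma ladder_count_incr p nu r : is_partition nu -> addr nu r ->
  ladder_count E a p (incr_nth nu r) =
  ((key (r.+1, (rw nu r).+1) == key p) + ladder_count E a p nu)%N.
Proof. by move=> pn hr; rewrite !ladder_countE (seq.permP (nodes_incr pn hr)). Qed.

Lemma equiv_incr la mu r s : is_partition la -> is_partition mu ->
  addr la r -> addr mu s ->
  key (r.+1, (rw la r).+1) = key (s.+1, (rw mu s).+1) ->
  ey_equivalent E a (incr_nth la r) (incr_nth mu s) <-> ey_equivalent E a la mu.
Proof.
move=> pl pm hr hs hk; split=> h p; have := h p; rewrite !ladder_count_incr // hk.
  by move/addnI.
by move=> ->.
Qed.

Lemma equiv_keys la mu : ey_equivalent E a la mu ->
  perm_eq (map key (nodes la)) (map key (nodes mu)).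
Proof.
move=> h; apply/allP => k; rewrite mem_cat.
have hc p : count_mem (key p) (map key (nodes la)) = count_mem (key p) (map key (nodes mu)).
  by have := h p; rewrite !ladder_countE !count_map.
by case/orP => /mapP[p _ ->] /=; rewrite hc.
Qed.

(** A step down, right or diagonally acts on keys by a fixed translation. Hence [sum_boundary] turns
    the height into a sum over nodes of a function of the key alone. *)
Lemma height_equiv i la mu (x : int) : is_partition la -> is_partition mu ->
  ey_equivalent E a la mu -> height e z a i la x = height e z a i mu x.
Proof.
move=> pl pm h.
pose P (k : int * int) : int := ((k.2 == i) && (x < k.1))%R%:Z.
pose F k := P k - P (k.1 + a, ((k.2 - 1) %% e)%Z) -
  P (k.1 + (E - a), ((k.2 + 1) %% e)%Z) + P (k.1 + E, k.2).
have res1 q : residue e (q.1.+1, q.2) = ((residue e q - 1) %% e)%Z.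
  by rewrite /residue modzDml /=; congr (_ %% _)%Z; lia.
have res2 q : residue e (q.1, q.2.+1) = ((residue e q + 1) %% e)%Z.
  by rewrite /residue modzDml /=; congr (_ %% _)%Z; lia.
have res3 q : residue e (shift11 q) = residue e q.
  by rewrite /residue /shift11 /=; congr (_ %% _)%Z; lia.
have hE nu : is_partition nu ->
    height e z a i nu x = P (key (1, 1)%N) - \sum_(k <- map key (nodes nu)) F k.
  move=> pn; rewrite /height !count_sum [in RHS]big_map.
  transitivity (\sum_(n <- addable nu) P (key n) -
                \sum_(m <- removable nu) P (key (shift11 m))).
    congr (_ - _); apply: eq_bigr => m _ //.
    by rewrite /P /= res3 lev_shift11.
  rewrite (sum_boundary (fun q => P (key q)) pn).
  congr (_ - _); apply: eq_bigr => q _.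
  rewrite /F /= /key res1 res2 res3 lev_shift11 //=.
  by case: q => r c /=; rewrite lev_row lev_col.
by rewrite !hE // (perm_big _ (equiv_keys h)).
Qed.

Lemma equiv_nil mu : is_partition mu -> ey_equivalent E a [::] mu -> mu = [::].
Proof.
case: mu => // n mu pm /(_ (1, 1)%N) /esym/eqP.
rewrite -leqn0 leqNgt; case/negP; rewrite ladder_countE -has_count.
apply/hasP; exists (1, 1)%N; rewrite ?eqxx // mem_nodes //=.
by have := partition_size 0 pm.
Qed.
End Ladders.

(** * Crystal operators and equivalence *)

Section Crystal.
Variables (e z : nat) (a : int).
Hypotheses (e2 : (2 <= e)%N) (z0 : (0 < z)%N) (az : coprimez a z).
Hypotheses (a0 : 0 < a) (aez : a < (e * z)%:Z).
Implicit Types (s t : bool) (i : int) (la mu nu rho : seq nat).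
Local Notation regular := (regular e z a).
Local Notation sig := (sig e z a).
Local Notation E := (e * z)%:Z.
Local Notation equiv := (ey_equivalent E a).

Let ez0 : (0 < e * z)%N.
Proof. by rewrite muln_gt0; lia. Qed.

Definition fop s i la : option (seq nat) :=
  match [seq p <- reduce_sig (sig s i la) | p.2] with
  | p :: _ => Some (incr_nth la p.1.1.-1)
  | [::] => None
  end.

Lemma fop_good s i la u p v :
  good true (sig s i la) u p v -> fop s i la = Some (incr_nth la p.1.1.-1).
Proof. by rewrite /fop => /first_plus_good[w ->]. Qed.

Lemma fop_some s i la mu : fop s i la = Some mu ->
  exists u p v, good true (sig s i la) u p v /\ mu = incr_nth la p.1.1.-1.
Proof.
move=> h; case: (plus_matched_or_good (sig s i la)) => [hm|[u [p [v hg]]]].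
  by move: h; rewrite /fop no_plus_reduce.
by exists u, p, v; split=> //; move: h; rewrite (fop_good hg) => -[].
Qed.

Lemma good_key s t i la mu b u p v u' p' v' :
  good b (sig s i la) u p v -> good b (sig t i mu) u' p' v' ->
  lev e z a p'.1 = lev e z a p.1 -> key e z a p'.1 = key e z a p.1.
Proof.
move=> /good_mem; rewrite mem_sig => /andP[/eqP h _].
move=> /good_mem; rewrite mem_sig => /andP[/eqP h' _] hl.
by rewrite /key hl h h'.
Qed.

Lemma fop_equiv s t i la mu la' :
  is_partition la -> is_partition mu -> regular s la -> regular t mu ->
  equiv la mu -> fop s i la = Some la' ->
  exists mu', [/\ fop t i mu = Some mu', is_partition mu', regular t mu' & equiv la' mu'].
Proof.
move=> pl pm rl rm h /fop_some[u [p [v [hg ->]]]].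
have hh x : height e z a i la x = height e z a i mu x by exact: height_equiv.
have [u' [p' [v' [hg' hl]]]] := good_transfer ez0 e2 a0 aez pl pm rl rm hh hg.
have [r [hr er _]] := good_plus_incr ez0 e2 pl rl hg.
have [r' [hr' er' rm']] := good_plus_incr ez0 e2 pm rm hg'.
exists (incr_nth mu r'); split=> //; first by rewrite (fop_good hg') er'.
  exact: partition_incr.
rewrite er /=; apply/(equiv_incr e2 z0 az) => //.
by rewrite -er -er'; apply/esym/(good_key hg hg').
Qed.

(** The induction step for both existence and uniqueness: the residue [i] is fixed before [mu], so
    good nodes of one ladder are removed from [la] and from every regular partition equivalent to
    it. *)
Lemma fop_preimage s la : is_partition la -> regular s la -> la != [::] ->
  exists i nu, [/\ is_partition nu, regular s nu, fop s i nu = Some la,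
     (size (nodes nu) < size (nodes la))%N &
     forall t mu, is_partition mu -> regular t mu -> equiv la mu ->
       exists rho, [/\ is_partition rho, regular t rho, fop t i rho = Some mu & equiv nu rho]].
Proof.
move=> pl rl la0; have [i [u [p [v hg]]]] := nonempty_good ez0 e2 a0 aez pl rl la0.
have [nu [r [[el ep hr pn] [rn hgn]]]] := good_minus_decr ez0 e2 pl rl hg.
exists i, nu; split=> //.
- by rewrite (fop_good hgn) ep el.
- by rewrite el (perm_size (nodes_incr pn hr)) /=.
move=> t mu pm rm h.
have hh x : height e z a i la x = height e z a i mu x by exact: height_equiv.
have [u' [p' [v' [hg' hl]]]] := good_transfer ez0 e2 a0 aez pl pm rl rm hh hg.
have [rho [r' [[em ep' hr' pr] [rr hgr]]]] := good_minus_decr ez0 e2 pm rm hg'.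
exists rho; split=> //; first by rewrite (fop_good hgr) ep' em.
move: h; rewrite el em; apply: (equiv_incr e2 z0 az _ _ _ _ _).1 => //.
by rewrite -ep -ep'; apply/esym/(good_key hg hg').
Qed.

Lemma regular_nil s : regular s [::].
Proof. by move=> r c k; rewrite nth_nil. Qed.

Lemma regular_transfer s t la : is_partition la -> regular s la ->
  exists mu, [/\ is_partition mu, regular t mu & equiv la mu].
Proof.
have [n] := ubnP (size (nodes la)); elim: n la => // n IH la hn pl rl.
have [->|la0] := eqVneq la [::].
  by exists [::]; split=> //; exact: regular_nil.
have [i [nu [pn rn hf hs _]]] := fop_preimage pl rl la0.
have [rho [pr rr hr]] := IH nu (leq_trans hs hn) pn rn.
have [mu [_ pm rm hm]] := fop_equiv pn pr rn rr hr hf.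
by exists mu.
Qed.

Lemma regular_unique s la mu : is_partition la -> is_partition mu ->
  regular s la -> regular s mu -> equiv la mu -> la = mu.
Proof.
have [n] := ubnP (size (nodes la)); elim: n la mu => // n IH la mu hn pl pm rl rm h.
have [e0|la0] := eqVneq la [::].
  by rewrite e0 in h *; rewrite (equiv_nil e2 z0 az pm h).
have [i [nu [pn rn hf hs hyp]]] := fop_preimage pl rl la0.
have [rho [pr rr hfr hr]] := hyp s mu pm rm h.
have e1 := IH nu rho (leq_trans hs hn) pn pr rn rr hr.
by move: hfr; rewrite -e1 hf => -[].
Qed.
End Crystal.

(** * Arm sequences and hooks *)

Lemma conj_col_foot la c k : is_partition la ->
  (c < rw la k)%N -> (rw la k.+1 <= c)%N -> conj_col la c.+1 = k.+1.
Proof.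
move=> pl h1 h2; have hk : (k.+1 <= size la)%N by rewrite partition_size //; lia.
rewrite /conj_col -{1}[la](cat_take_drop k.+1) count_cat.
have -> : count (fun x => c.+1 <= x)%N (take k.+1 la) = k.+1.
  rewrite -{2}(size_takel hk); apply/eqP; rewrite -all_count.
  apply/(all_nthP 0%N) => j; rewrite size_takel // => hj; rewrite nth_take //.
  by have := partition_anti pl (hj : (j <= k)%N); lia.
rewrite [X in (_ + X)%N](_ : _ = 0%N) ?addn0 //.
apply/eqP; rewrite -leqn0 leqNgt -has_count; apply/(has_nthP 0%N) => -[j _].
by rewrite nth_drop; have := partition_anti pl (leq_addr j k.+1); lia.
Qed.

Lemma foot_exists la r c : is_partition la -> (c < rw la r)%N ->
  exists2 k, (c < rw la k)%N & (rw la k.+1 <= c)%N.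
Proof.
move=> pl h; pose P k := (c < rw la k)%N.
have hP k : P k -> (k <= size la)%N.
  by rewrite /P => hk; rewrite ltnW // partition_size //; lia.
case: (ex_maxnP (ex_intro P r h) hP) => k hk hmax; exists k => //.
by rewrite leqNgt; apply/negP => /hmax; rewrite ltnn.
Qed.

Section Arms.
Variables (e z : nat) (a : int) (s : bool) (A : nat -> int).
Hypotheses (e0 : (0 < e)%N).
(** Makes [A t] the largest integer at most, or strictly below, [a t / z]. One hypothesis thus
    covers the floor, the shifted ceiling, and the integer slopes obtained for [z = 1]. *)
Hypothesis hA : forall (t : nat) (k : int), (0 < t)%N ->
  (k <= A t) = (if s then z%:Z * k <= a * t%:Z else z%:Z * k < a * t%:Z).

(** The level difference is [e] times [z (k - c) - a t], and [t > 0] fixes the order of contents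
    that settles ties. As [k - c] is the arm length plus one, the two comparisons together say that
    the arm length is [A t]. *)
Lemma hook_nle r k c f (t : nat) : (0 < t)%N ->
  k%:Z - r%:Z - c%:Z + f%:Z = e%:Z * t%:Z ->
  nle e z a s (f.+1, c.+1) (r.+1, k.+1) = ~~ (k%:Z - c%:Z <= A t) /\
  nle e z a s (r.+1, k.+1) (f.+2, c.+2) = (k%:Z - c%:Z - 1 <= A t).
Proof.
move=> t0 h; rewrite !hA // /nle.
have hc1 : cont (r.+1, k.+1) - cont (f.+1, c.+1) = e%:Z * t%:Z.
  by rewrite /cont /= -h; lia.
have hc2 : cont (f.+2, c.+2) = cont (f.+1, c.+1) by rewrite /cont /=; lia.
have et0 : 0 < e%:Z * t%:Z by nia.
have hl1 : lev e z a (r.+1, k.+1) - lev e z a (f.+1, c.+1) =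
    e%:Z * (z%:Z * (k%:Z - c%:Z) - a * t%:Z).
  rewrite /lev /= PoszM (_ : r.+1%:Z = f.+1%:Z + k%:Z - c%:Z - e%:Z * t%:Z); last by lia.
  by rewrite -!natz -!natr1 !natz; ring.
have hl2 : lev e z a (f.+2, c.+2) - lev e z a (r.+1, k.+1) =
    e%:Z * (a * t%:Z - z%:Z * (k%:Z - c%:Z - 1)).
  transitivity (e%:Z * z%:Z - (lev e z a (r.+1, k.+1) - lev e z a (f.+1, c.+1))).
    by rewrite lev_row lev_col PoszM; ring.
  by rewrite hl1; ring.
rewrite hc2.
move: (lev e z a (f.+1, c.+1)) (lev e z a (r.+1, k.+1)) (lev e z a (f.+2, c.+2)) hl1 hl2.
move: (cont (f.+1, c.+1)) (cont (r.+1, k.+1)) hc1 => c1 c2 hc1 l1 l2 l3 hl1 hl2.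
set X := z%:Z * (k%:Z - c%:Z) in hl1 *; set Y := z%:Z * (_ - 1) in hl2 *.
move: (a * t%:Z) hl1 hl2 => W hl1 hl2.
have d1 : ((l1 < l2) = (W < X)) * ((l1 == l2) = (W == X)) by split; nia.
have d2 : ((l2 < l3) = (Y < W)) * ((l2 == l3) = (Y == W)) by split; nia.
by rewrite !d1 !d2; case: (s); split; lia.
Qed.

Lemma A_regularP la : is_partition la -> A_regular e A la <-> regular e z a s la.
Proof.
move=> pl; split=> [hreg r c k h1 h2 h3|hreg [r c] t].
  rewrite sameE /cont /= => /dvdzP[t ht] h4 h5.
  have rk : (r <= k)%N.
    by rewrite leqNgt; apply/negP => hk; have := partition_anti pl hk; lia.
  have t0 : 0 < t by nia.
  case: t ht t0 => // t ht t0; have t1 : (0 < t)%N by lia.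
  have heq : (rw la r)%:Z - r%:Z - c%:Z + k%:Z = e%:Z * t%:Z.
    by rewrite mulrC -ht; lia.
  have [n1 n2] := hook_nle t1 heq; rewrite n1 in h4; rewrite n2 in h5.
  apply: (hreg (r.+1, c.+1) t); rewrite ?mem_nodes //=.
  rewrite /hook_length /arm_length /= (conj_col_foot pl h2 h3) /part_row /=.
  by rewrite PoszM -heq; split; lia.
rewrite mem_nodes //=; case: r c => [|r] [|c] //= hc t0 [].
have [k h2 h3] := foot_exists pl hc.
rewrite /hook_length /arm_length /= (conj_col_foot pl h2 h3) /part_row /= => hl ha.
have heq : (rw la r)%:Z - r%:Z - c%:Z + k%:Z = e%:Z * t%:Z.
  by rewrite -PoszM -hl; lia.
have [n1 n2] := hook_nle t0 heq.
apply: (hreg r c k) => //; rewrite ?n1 ?n2 -?ha; try lia.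
rewrite sameE /cont /=; apply/dvdzP; exists t%:Z; rewrite mulrC -heq; lia.
Qed.

(** The quotient [t] in [precb] is the exact content difference divided by [e]. The level difference
    is [e] times [a t - z (c - c')], so [hA] at [t] or at [-t] converts one comparison into the
    other. *)
Lemma precb_nle x y : (0 < z)%N -> same e x y -> precb e A x y = nle e z a s x y.
Proof.
move=> z0; rewrite sameE => /dvdzP[t ht].
case: x y ht => [r c] [r' c']; rewrite /cont /= => ht.
rewrite /precb /= (_ : r'%:Z - r%:Z + c%:Z - c'%:Z = t * e%:Z); last by lia.
rewrite mulzK; last by lia.
have hl : lev e z a (r', c') - lev e z a (r, c) =
   e%:Z * (a * t - z%:Z * (c%:Z - c'%:Z)).
  rewrite /lev /= PoszM (_ : r'%:Z = r%:Z + t * e%:Z - c%:Z + c'%:Z); last by lia.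
  by ring.
have hc : cont (r, c) - cont (r', c') = t * e%:Z by rewrite /cont /= -ht; lia.
rewrite /nle; move: (lev e z a (r, c)) (lev e z a (r', c')) hl => l1 l2 hl.
move: (cont (r, c)) (cont (r', c')) hc => c1 c2 hc.
have hd (W X : int) : l2 - l1 = e%:Z * (W - X) ->
    ((l1 < l2) = (X < W)) * ((l1 == l2) = (X == W)).
  by move=> hh; split; nia.
rewrite !(hd _ _ hl) => {hd hl}.
have hcc : ((c2 <= c1) = (0 <= t)) * ((c1 <= c2) = (t <= 0)) by split; nia.
rewrite !hcc; case: t ht {hc hcc} => [[|t]|t] ht /=.
- have -> : Aext A 0%Z = 0 by [].
  have [h|h|->] := ltgtP (c%:Z - c'%:Z) 0; last by rewrite !mulr0 ltxx eqxx; case: (s).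
    by have : z%:Z * (c%:Z - c'%:Z) < 0 by [nia]; case: (s); lia.
  by have : 0 < z%:Z * (c%:Z - c'%:Z) by [nia]; case: (s); lia.
- by have -> : Aext A t.+1 = A t.+1 by []; rewrite hA //; case: (s); lia.
rewrite NegzE opprK; have -> : Aext A t.+1 = A t.+1 by []; rewrite hA //.
rewrite -(opprB c%:Z) !mulrN.
by case: (s); lia.
Qed.
End Arms.

(** * The isomorphism *)

Lemma A_plus_ge (y : rat) (t : nat) (k : int) :
  (k <= A_plus y t) = (denq y * k <= numq y * t%:Z).
Proof.
rewrite /A_plus floor_ge_int -{1}[y]divq_num_den mulrAC ler_pdivlMr; last first.
  by rewrite ltr0z denq_gt0.
by rewrite -[t%:R]/(t%:Z%:~R) -!intrM ler_int mulrC.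
Qed.

Lemma A_minus_ge (y : rat) (t : nat) (k : int) :
  (k <= A_minus y t) = (denq y * k < numq y * t%:Z).
Proof.
rewrite /A_minus (_ : (k <= _) = (k - 1 < Num.ceil (y * t%:R - 1))); last by lia.
rewrite ceil_gt_int intrB ltrD2r -{1}[y]divq_num_den mulrAC ltr_pdivlMr; last first.
  by rewrite ltr0z denq_gt0.
by rewrite -[t%:R]/(t%:Z%:~R) -!intrM ltr_int mulrC.
Qed.

(** [precb] and [nle] agree only on nodes of equal residue, so the sort is moved to the subtype cut
    out by [P], where the two relations are equal as functions. *)
Lemma eq_in_sort (T : Type) (P : {pred T}) (r r' : rel T) s :
  {in P &, r =2 r'} -> all P s -> sort r s = sort r' s.
Proof.
move=> h /all_sigP[t ->]; rewrite !sort_map; congr map; congr sort.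
by do 2![apply: functional_extensionality => -[? ?]]; apply: h.
Qed.

Section ArmCrystal.
Variables (e z : nat) (a : int) (s : bool) (A : nat -> int).
Hypotheses (e2 : (2 <= e)%N) (z0 : (0 < z)%N).
Hypothesis hA : forall (t : nat) (k : int), (0 < t)%N ->
  (k <= A t) = (if s then z%:Z * k <= a * t%:Z else z%:Z * k < a * t%:Z).

Lemma f_op_fop (i : 'I_e) la : f_op e A i la = fop e z a s (i : nat)%:Z la.
Proof.
suff h : signature e A i la = sig e z a s (i : nat)%:Z la by rewrite /f_op h.
apply: (@eq_in_sort _ [pred p | residue e p.1 == (i : nat)%:Z]).
  move=> p q /eqP hp /eqP hq; apply: (precb_nle _ hA) => //; first by lia.
  by rewrite /same hp hq.
by rewrite all_cat !all_map; apply/andP; split; apply/allP => x; rewrite mem_filter => /andP[].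
Qed.

Lemma in_RAP la : in_RA e A la <-> is_partition la /\ regular e z a s la.
Proof.
by split=> -[pl h]; split=> //; apply/(A_regularP (ltnW e2) hA).
Qed.
End ArmCrystal.

(** Denominator 1 and the strict case: [a t - 1] is the largest integer below [a t]. *)
Lemma ey_regularP E (a : int) la : (0 < E)%N -> is_partition la ->
  ey_regular E%:Z a la <-> regular E 1 a false la.
Proof.
move=> E0 pl; rewrite -(@A_regularP E 1 a false (fun t => a * t%:Z - 1) E0) //.
by move=> t k _; lia.
Qed.

Lemma ey_restrictedP E (a : int) la : (0 < E)%N -> is_partition la ->
  ey_restricted E%:Z a la <-> regular E 1 a true la.
Proof.
move=> E0 pl; rewrite -(@A_regularP E 1 a true (fun t => a * t%:Z) E0) //.
by move=> t k _; rewrite mul1r.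
Qed.

(* At [t = z u] the order with slope [a / z] has the same tight hooks as the
   order with slope [a] for [e z] in place of [e]. *)
Lemma regular_coarse e z a s la : (0 < e)%N -> (0 < z)%N -> is_partition la ->
  regular e z a s la -> regular (e * z) 1 a s la.
Proof.
move=> e0 z0 pl h r c k h1 h2 h3 h4 h5 h6; apply: (h r c k) => //.
- move: h4; rewrite !sameE => /dvdzP[t ->]; apply/dvdzP.
  by exists (t * z%:Z); rewrite PoszM; ring.
- by move: h5; rewrite /nle /lev muln1.
- by move: h6; rewrite /nle /lev muln1.
Qed.

Lemma equiv_sym E a la mu : ey_equivalent E a la mu -> ey_equivalent E a mu la.
Proof. by move=> h p; rewrite h. Qed.

Lemma equiv_trans E a la mu nu :
  ey_equivalent E a la mu -> ey_equivalent E a mu nu -> ey_equivalent E a la nu.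
Proof. by move=> h1 h2 p; rewrite h1. Qed.

Theorem mainTheorem6 (e : nat) (y : rat) :
  (3 <= e)%N -> 1 <= y <= e%:R - 1 ->
  let reg := regularisation (e%:Z * denq y) (numq y) in
  let res := restrictisation (e%:Z * denq y) (numq y) in
  (forall la, in_RA e (A_plus y) la -> in_RA e (A_minus y) (reg la)) /\
  (forall mu, in_RA e (A_minus y) mu -> in_RA e (A_plus y) (res mu)) /\
  (forall la, in_RA e (A_plus y) la -> res (reg la) = la) /\
  (forall mu, in_RA e (A_minus y) mu -> reg (res mu) = mu) /\
  (forall (i : 'I_e) la mu, in_RA e (A_plus y) la -> in_RA e (A_plus y) mu ->
     (f_op e (A_plus y) i la = Some mu <->
      f_op e (A_minus y) i (reg la) = Some (reg mu))).
Proof.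
move=> e3 /andP[y1 ye] /=; set a := numq y; pose z := `|denq y|%N.
have zE : denq y = z%:Z by rewrite /z gez0_abs ?denq_ge0.
rewrite zE -PoszM; set E := (e * z)%N.
have z0 : (0 < z)%N by have := denq_gt0 y; lia.
have e2 : (2 <= e)%N by lia.
have az : coprimez a z by rewrite -zE /coprimez; have := coprime_num_den y.
have a0 : 0 < a by rewrite numq_gt0; apply: lt_le_trans y1.
have aE : a < E%:Z.
  rewrite /E PoszM -zE -(ltr_int rat) intrM -ltr_pdivrMr ?ltr0z ?denq_gt0 //.
  by rewrite divq_num_den; apply: le_lt_trans ye _; rewrite -[e%:R]/(e%:Z%:~R) ltrBlDr ltrDl.
have E0 : (0 < E)%N by lia.
have E2 : (2 <= E)%N by lia.
have a1 : coprimez a 1%N by rewrite /coprimez gcdz1.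
have aE1 : a < (E * 1)%N%:Z by rewrite muln1.
have hP t k : (0 < t)%N -> (k <= A_plus y t) = (z%:Z * k <= a * t%:Z).
  by rewrite A_plus_ge zE.
have hM t k : (0 < t)%N -> (k <= A_minus y t) = (z%:Z * k < a * t%:Z).
  by rewrite A_minus_ge zE.
have RP := @in_RAP e z a true (A_plus y) e2 hP.
have RM := @in_RAP e z a false (A_minus y) e2 hM.
have fP := @f_op_fop e z a true (A_plus y) e2 z0 hP.
have fM := @f_op_fop e z a false (A_minus y) e2 z0 hM.
(* The crystal argument is rerun with [E] for [e] and denominator 1. *)
have uniq s la mu : is_partition la -> is_partition mu -> regular E 1 a s la ->
    regular E 1 a s mu -> ey_equivalent E a la mu -> la = mu.
  move=> pl pm rl rm h; apply: (regular_unique E2 _ a1 a0 aE1 pl pm rl rm) => //.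
  by rewrite muln1.
have coarse s la : is_partition la -> regular e z a s la -> regular E 1 a s la.
  by apply: regular_coarse => //; lia.
have transfer s t la : is_partition la -> regular e z a s la ->
  exists mu, [/\ is_partition mu, regular e z a t mu & ey_equivalent E a la mu].
  exact: (regular_transfer e2 z0 az a0 aE).
(* [coarse] makes [mu] a candidate for [epsilon], and [uniq] identifies the chosen partition with
   it. *)
have regE la mu : is_partition mu -> regular e z a false mu ->
    ey_equivalent E a la mu -> regularisation E a la = mu.
  move=> pm rm h; rewrite /regularisation.
  have := epsilon_spec (inhabits la)
    (fun mu => is_partition mu /\ ey_regular E a mu /\ ey_equivalent E a la mu).
  case.
    by exists mu; split=> //; split=> //; apply/ey_regularP => //; apply: coarse.
  set mu' := epsilon _ _ => pm' [/ey_regularP rm' hm'].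
  apply: (uniq false) => //; [exact: rm' | exact: coarse |].
  exact: equiv_trans (equiv_sym hm') h.
have resE la mu : is_partition mu -> regular e z a true mu ->
    ey_equivalent E a la mu -> restrictisation E a la = mu.
  move=> pm rm h; rewrite /restrictisation.
  have := epsilon_spec (inhabits la)
    (fun mu => is_partition mu /\ ey_restricted E a mu /\ ey_equivalent E a la mu).
  case.
    by exists mu; split=> //; split=> //; apply/ey_restrictedP => //; apply: coarse.
  set mu' := epsilon _ _ => pm' [/ey_restrictedP rm' hm'].
  apply: (uniq true) => //; [exact: rm' | exact: coarse |].
  exact: equiv_trans (equiv_sym hm') h.
have regS la : in_RA e (A_plus y) la -> [/\ is_partition (regularisation E a la),
    regular e z a false (regularisation E a la) &
    ey_equivalent E a la (regularisation E a la)].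
  move=> /RP[pl rl]; have [mu [pm rm h]] := transfer true false la pl rl.
  by rewrite (regE la mu).
have resS la : in_RA e (A_minus y) la -> [/\ is_partition (restrictisation E a la),
    regular e z a true (restrictisation E a la) &
    ey_equivalent E a la (restrictisation E a la)].
  move=> /RM[pl rl]; have [mu [pm rm h]] := transfer false true la pl rl.
  by rewrite (resE la mu).
split; first by move=> la /regS[h1 h2 _]; apply/RM.
split; first by move=> la /resS[h1 h2 _]; apply/RP.
split.
  move=> la hla; have [h1 h2 h3] := regS _ hla; have [pl rl] := (RP la).1 hla.
  by apply: resE => //; apply: equiv_sym.
split.
  move=> la hla; have [h1 h2 h3] := resS _ hla; have [pl rl] := (RM la).1 hla.
  by apply: regE => //; apply: equiv_sym.
move=> i la mu hla hmu; rewrite fP fM.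
have [h1 h2 h3] := regS _ hla; have [k1 k2 k3] := regS _ hmu.
have [pl rl] := (RP la).1 hla; have [pm rm] := (RP mu).1 hmu.
split=> hf.
  have [nu [-> pn rn hn]] := fop_equiv e2 z0 az a0 aE pl h1 rl h2 h3 hf.
  by rewrite (regE mu nu).
(* The arrow between the regularisations is carried back to an arrow from [la] to some [nu]
   equivalent to the regularisation of [mu], hence to [mu]; uniqueness gives [nu = mu]. *)
have [nu [-> pn rn hn]] := fop_equiv e2 z0 az a0 aE h1 pl h2 rl (equiv_sym h3) hf.
congr Some; apply: (uniq true) => //; try exact: coarse.
exact: equiv_sym (equiv_trans k3 hn).
Qed.
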